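(* Let $Y$ be a space with Fréchet differentiable norm (in the sense described in the context) such that $BV(\mathbb R^d)$ is embedded in $Y'$ in the sense that, for some constant $\beta$, $$\|v\|_{Y'}\le\beta|v|_{TV},\qquad v\in BV(\mathbb R^d).$$ Let $f\in Y$, $f\neq0$, put $\eta:=\beta/2$, $\lambda_1:=\dfrac{2\eta}{\|f\|_Y}$ and $\lambda_j:=\lambda_12^{j-1}$ for $j\ge1$. Set $r_0:=f$ and, for $j\ge1$, let iteratively $\mathbf u_j$ be the minimizer of $$\mathcal V_j(\mathbf u)=\|\mathbf u\|_{L^\infty}+\lambda_j\|r_{j-1}-\operatorname{div}\mathbf u\|_Y^2,\qquad\text{and}\qquad r_j:=r_{j-1}-\operatorname{div}\mathbf u_j .$$ Then the sum of the $\mathbf u_j$ converges in $L^\infty$ to a limit $\mathbf u=\sum_{j=1}^\infty\mathbf u_j$ which is a solution of $\operatorname{div}\mathbf u=f$ and satisfies $$\|\mathbf u\|_{L^\infty}\le2\beta\|f\|_Y .$$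
   Context: Here $d\ge2$ and $Y=Y(\mathbb R^d)$ is a Banach space with dual $Y'$. It is assumed to be a dual space of distributions, $Y=Z'$ with $\|v\|_Y=\sup\{\langle v,\varphi\rangle_{Y,Z}:\varphi\in\mathcal D(\mathbb R^d),\ \|\varphi\|_Z\le1\}$, where $\mathcal D(\mathbb R^d)$ is the space of test functions; this ensures that minimizers exist (they need not be unique; $\mathbf u_j$ is any minimizer). The functionals are minimized over vector fields in $L^\infty(\mathbb R^d)$ and take the value $+\infty$ when the residual is not in $Y$. The norm of $Y$ is called Fréchet differentiable if there exists $\phi:Y\to Y'$ such that $\|v+\epsilon w\|_Y=\|v\|_Y+\epsilon\langle\phi(v),w\rangle+o(\epsilon)$ for all $v,w\in Y$, $v\ne0$. For vector fields, $\|\mathbf u\|_{L^\infty}=\operatorname{ess\,sup}_x|\mathbf u(x)|_2$, with $|\cdot|_2$ the Euclidean norm; the divergence is distributional. $BV(\mathbb R^d)$ is the space of functions of bounded variation, and $|v|_{TV}:=\sup\{\int_{\mathbb R^d}v\operatorname{div}\mathbf w:\ \mathbf w\in\mathcal D(\mathbb R^d)^d,\ \|\mathbf w\|_{L^\infty}\le1\}$. *)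

(* Defs.v *)
From HB Require Import structures.
From mathcomp Require Import all_boot all_order all_algebra.
From mathcomp Require Import all_classical all_reals all_analysis.
From mathcomp Require Import ess_sup_inf.
Set Implicit Arguments.
Unset Strict Implicit.
Unset Printing Implicit Defensive.
Import Order.TTheory GRing.Theory Num.Theory.
Import numFieldNormedType.Exports.
Local Open Scope classical_set_scope.
Local Open Scope ring_scope.

(* R^d is 'rV[R]_d.  Its topology is that of the library (sup norm); its
   sigma-algebra, generated by the coordinates, is the Borel one. *)
Definition rV_display : measure_display.
Proof. exact: default_measure_display. Qed.

Section measurable_rV.
Context (R : realType) (n : nat).

Let coord : 'I_n -> 'rV[R]_n -> measurableTypeR R := fun i x => x ord0 i.

Definition measurable_rV : set (set 'rV[R]_n) := g_sigma_preimage coord.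

Let measurable_rV0 : measurable_rV set0.
Proof. exact: sigma_algebra0. Qed.

Let measurable_rVC A : measurable_rV A -> measurable_rV (~` A).
Proof. exact: sigma_algebraC. Qed.

Let measurable_rV_bigcup (F : (set 'rV[R]_n)^nat) :
  (forall i, measurable_rV (F i)) -> measurable_rV (\bigcup_i F i).
Proof. exact: sigma_algebra_bigcup. Qed.

HB.instance Definition _ := @isMeasurable.Build rV_display 'rV[R]_n
  measurable_rV measurable_rV0 measurable_rVC measurable_rV_bigcup.

Lemma measurable_coord (i : 'I_n) :
  measurable_fun [set: 'rV[R]_n] (fun x : 'rV[R]_n => x ord0 i).
Proof.
move=> _ A mA; rewrite setTI; apply: sub_sigma_algebra => /=.
rewrite -bigcup_seq/=; exists i => /=; first by rewrite mem_index_enum.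
by exists A => //; rewrite setTI.
Qed.

Lemma measurable_fun_rV d (T : measurableType d) (f : T -> 'rV[R]_n) :
  (forall i, measurable_fun [set: T] (fun x => f x ord0 i)) ->
  measurable_fun [set: T] f.
Proof.
move=> mf; have fS : preimage_set_system [set: T] f measurable `<=` measurable.
  rewrite [X in preimage_set_system _ _ X]/measurable/= /measurable_rV.
  rewrite -g_sigma_preimage_comp.
  apply: smallest_sub; first exact: sigma_algebra_measurable.
  rewrite -bigcup_seq => A [i _] [B mB <-].
  exact: mf.
by move=> _ A mA; apply: fS; exists A.
Qed.

End measurable_rV.

(* Lebesgue measure on 'rV[R]_n, by iterated products: the point (a, v) of
   R * R^n is sent to the row vector with first coordinate a followed by v. *)
Section lebesgue_rV.
Context (R : realType).

Definition rV_cons n (p : measurableTypeR R * 'rV[R]_n) : 'rV[R]_n.+1 :=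
  \row_i oapp (p.2 ord0) p.1 (unlift ord0 i).

Lemma measurable_rV_cons n : measurable_fun [set: _] (@rV_cons n).
Proof.
apply: measurable_fun_rV => i; case: (unliftP ord0 i) => [j|] ->.
- have -> : (fun p => @rV_cons n p ord0 (lift ord0 j)) =
      (fun x : 'rV[R]_n => x ord0 j) \o snd.
    by apply/funext => p /=; rewrite mxE liftK.
  by apply: measurableT_comp; [exact: measurable_coord|exact: measurable_snd].
- have -> : (fun p => @rV_cons n p ord0 ord0) = fst.
    by apply/funext => p /=; rewrite mxE unlift_none.
  exact: measurable_fst.
Qed.

Section step.
Context (n : nat) (m : {sigma_finite_measure set 'rV[R]_n -> \bar R}).

Definition lebesgue_cons : set 'rV[R]_n.+1 -> \bar R :=
  pushforward (@lebesgue_measure R \x m)%E (@rV_cons n).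

Let lebesgue_cons0 : lebesgue_cons set0 = 0%E.
Proof. by rewrite /lebesgue_cons /pushforward preimage_set0 measure0. Qed.

Let lebesgue_cons_ge0 A : (0 <= lebesgue_cons A)%E.
Proof. by rewrite /lebesgue_cons /pushforward measure_ge0. Qed.

Let lebesgue_cons_sigma_additive : semi_sigma_additive lebesgue_cons.
Proof.
pose p := measure_function_pushforward__canonical__measure_function_Measure
  (@lebesgue_measure R \x m)%E (@measurable_rV_cons n).
exact: (@measure_semi_sigma_additive _ _ _ p).
Qed.

HB.instance Definition _ := isMeasure.Build _ _ _ lebesgue_cons
  lebesgue_cons0 lebesgue_cons_ge0 lebesgue_cons_sigma_additive.

Let lebesgue_cons_sigma_finite : sigma_finite setT lebesgue_cons.
Proof.
have /sigma_finiteP[A [AT ndA Aoo]] := sigma_finiteT (@lebesgue_measure R).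
have /sigma_finiteP[B [BT ndB Boo]] := sigma_finiteT m.
pose g (x : 'rV[R]_n.+1) : measurableTypeR R * 'rV[R]_n :=
  (x ord0 ord0, \row_j x ord0 (lift ord0 j)).
have gK : cancel (@rV_cons n) g.
  move=> [a v]; rewrite /g/= !mxE unlift_none/=; congr pair.
  by apply/rowP => j; rewrite !mxE liftK.
have mg : measurable_fun [set: _] g.
  apply/measurable_fun_pairP; split; first exact: measurable_coord.
  apply: measurable_fun_rV => j.
  have -> : (fun x => (snd \o g) x ord0 j) =
      (fun x : 'rV[R]_n.+1 => x ord0 (lift ord0 j)).
    by apply/funext => x /=; rewrite mxE.
  exact: measurable_coord.
exists (fun k => g @^-1` (A k `*` B k)).
  rewrite -preimage_bigcup (_ : \bigcup_k _ = setT) ?preimage_setT//.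
  apply/seteqP; split=> // -[x y] _.
  have [i _ Aix] : (\bigcup_i A i) x by rewrite -AT.
  have [j _ Bjy] : (\bigcup_j B j) y by rewrite -BT.
  exists (maxn i j) => //; split => /=.
    by move: x Aix; exact/subsetPset/ndA/leq_maxl.
  by move: y Bjy; exact/subsetPset/ndB/leq_maxr.
move=> k; have [mA Ak] := Aoo k; have [mB Bk] := Boo k; split.
  by rewrite -[X in measurable X]setTI; apply: mg => //; exact: measurableX.
rewrite /lebesgue_cons /pushforward (_ : _ @^-1` _ = A k `*` B k).
  by rewrite product_measure1E// lte_mul_pinfty// ge0_fin_numE.
by apply/funext => x; rewrite /preimage /mkset gK.
Qed.

HB.instance Definition _ := Measure_isSigmaFinite.Build _ _ _ lebesgue_cons
  lebesgue_cons_sigma_finite.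

End step.

Fixpoint lebesgue_rV n : {sigma_finite_measure set 'rV[R]_n -> \bar R} :=
  match n with
  | 0 => dirac (0 : 'rV[R]_0)
  | n.+1 => lebesgue_cons (lebesgue_rV n)
  end.

Lemma lebesgue_rV_box n (A : 'I_n -> set (measurableTypeR R)) :
  (forall i, measurable (A i)) ->
  lebesgue_rV n [set x | forall i, A i (x ord0 i)] =
  (\prod_(i < n) lebesgue_measure (A i))%E.
Proof.
elim: n A => [|n IH] A mA.
  rewrite big_ord0 /= -[RHS](diracT R (0 : 'rV[R]_0)); congr (dirac _ _).
  by apply/seteqP; split=> // x _ [].
rewrite big_ord_recl -IH//= /lebesgue_cons /pushforward.
rewrite (_ : _ @^-1` _ =
    A ord0 `*` [set x : 'rV[R]_n | forall i, A (lift ord0 i) (x ord0 i)]).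
  rewrite product_measure1E//.
  have -> : [set x : 'rV[R]_n | forall i, A (lift ord0 i) (x ord0 i)] =
      \bigcap_(i in [set: 'I_n])
        (fun x : 'rV[R]_n => x ord0 i) @^-1` A (lift ord0 i).
    by apply/seteqP; split=> [x xA i _|x xA i]; exact: xA.
  apply: fin_bigcap_measurable => [|i _]; first exact: finite_finset.
  have := @measurable_coord R n i measurableT _ (mA (lift ord0 i)).
  by rewrite setTI.
apply/seteqP; split=> [[a v] /= vA|[a v] [/= aA vA] i].
  split=> [|i]; first by have := vA ord0; rewrite mxE unlift_none.
  by have := vA (lift ord0 i); rewrite mxE liftK.
by case: (unliftP ord0 i) => [j|] ->; rewrite mxE ?liftK ?unlift_none//; exact: vA.
Qed.

End lebesgue_rV.

Section test_functions.
Context (R : realType) (d : nat).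
Implicit Types f : 'rV[R]_d -> R.

Definition partial (i : 'I_d) f : 'rV[R]_d -> R := 'D_(delta_mx ord0 i) f.

Definition partials (s : seq 'I_d) f : 'rV[R]_d -> R := foldr partial f s.

Definition smooth f : Prop := forall s : seq 'I_d,
  continuous (partials s f) /\
  forall (i : 'I_d) (x : 'rV[R]_d),
    derivable (partials s f) x (delta_mx ord0 i).

Definition support_closure f : set 'rV[R]_d := closure [set x | f x != 0].

Definition test_pred : {pred 'rV[R]_d -> R} :=
  mem [set f | smooth f /\ compact (support_closure f)].

Lemma test_predP f :
  reflect (smooth f /\ compact (support_closure f)) (f \in test_pred).
Proof. by apply: (iffP idP) => [/set_mem|/mem_set]. Qed.

Lemma partials_lin (a : R) f g s : smooth f -> smooth g ->
  partials s (a *: f + g) = a *: partials s f + partials s g.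
Proof.
move=> sf sg; elim: s => [//|i s IH]; rewrite /= -/(partials s _) IH.
apply/funext => x; have [_ df] := sf s; have [_ dg] := sg s.
have daf : derivable (a *: partials s f) x (delta_mx ord0 i).
  exact: derivableZ.
by rewrite /partial deriveD// deriveZ.
Qed.

Lemma smooth0 : smooth (0 : 'rV[R]_d -> R).
Proof.
have p0 s : partials s (0 : 'rV[R]_d -> R) = cst 0.
  elim: s => [//|i s IH]; rewrite /= -/(partials s _) IH.
  by apply/funext => x; rewrite /partial derive_cst.
by move=> s; rewrite p0; split=> [x|i x]; [exact: cst_continuous|exact: derivable_cst].
Qed.

Lemma smooth_lin (a : R) f g : smooth f -> smooth g -> smooth (a *: f + g).
Proof.
move=> sf sg s; rewrite partials_lin//; have [cf df] := sf s; have [cg dg] := sg s.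
split=> [x|i x]; last by apply: derivableD => //; exact: derivableZ.
apply: continuousD; last exact: cg.
by apply: continuousZl_tmp; exact: cf.
Qed.

Lemma test_submod_closed : submod_closed test_pred.
Proof.
split=> [|a f g /test_predP[sf cf] /test_predP[sg cg]]; apply/test_predP.
  split; first exact: smooth0.
  rewrite /support_closure (_ : [set _ | _] = set0) ?closure0; first exact: compact0.
  by apply/seteqP; split=> // x /=; rewrite eqxx.
split; first exact: smooth_lin.
apply: (@subclosed_compact _ _ (support_closure f `|` support_closure g)).
- exact: closed_closure.
- exact: compactU.
- rewrite /support_closure -closureU; apply: closure_subset => x /=.
  have [fx0|] := eqVneq (f x) 0; last by left.
  have [gx0|] := eqVneq (g x) 0; last by right.
  by rewrite !fctE fx0 gx0 scaler0 addr0 eqxx.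
Qed.

HB.instance Definition _ :=
  GRing.isSubmodClosed.Build _ _ test_pred test_submod_closed.

Record testfun := TestFun {
  testfun_val :> 'rV[R]_d -> R;
  testfunP : testfun_val \in test_pred }.

HB.instance Definition _ := [isSub for testfun_val].
HB.instance Definition _ := [Choice of testfun by <:].
HB.instance Definition _ := [SubChoice_isSubLmodule of testfun by <:].

(* Continuity on D(R^d) is the usual seminorm estimate: on test functions
   supported in K, |T phi| <= C max_{|s| <= N} sup |partials s phi|; M ranges
   over the upper bounds of these derivatives. *)
Definition is_distribution (T : testfun -> R) : Prop :=
  scalar T /\
  forall K : set 'rV[R]_d, compact K -> exists (C : R) (N : nat),
    forall (phi : testfun) (M : R), support_closure phi `<=` K ->
      (forall s, (size s <= N)%N -> forall x, `|partials s phi x| <= M) ->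
      `|T phi| <= C * M.

End test_functions.

Section functionals.
Context (R : realType) (V : normedModType R).

(* L is an element of the topological dual of V. *)
Definition is_dual (L : V -> R) : Prop :=
  scalar L /\ continuous L.

Definition dual_norm (L : V -> R) : \bar R :=
  ereal_sup [set `|L v|%:E | v in [set v : V | `|v| <= 1]].

(* The expansion is required direction by direction: the remainder is o(e) for
   fixed v and w, without uniformity in w. *)
Definition frechet_differentiable_norm : Prop :=
  exists2 Phi : V -> V -> R, (forall v, is_dual (Phi v)) &
    forall v w : V, v != 0 ->
      (fun e : R => `|v + e *: w|) =
      (fun e : R => `|v| + e * Phi v w) +o_ (0 : R) (fun e : R => e).
End functionals.

Section vector_fields.
Context (R : realType) (d : nat).
Local Notation mu := (lebesgue_rV R d).
Implicit Types (u : 'rV[R]_d -> 'rV[R]_d) (v : 'rV[R]_d -> R).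

(* The library norm on 'rV[R]_d is the sup norm, hence this definition. *)
Definition euclid_norm (x : 'rV[R]_d) : R := Num.sqrt (\sum_(i < d) x ord0 i ^+ 2).

Definition Linfty_norm u : \bar R := ess_sup mu (fun x => (euclid_norm (u x))%:E).

Definition in_Linfty u : Prop :=
  measurable_fun [set: 'rV[R]_d] u /\ (Linfty_norm u < +oo)%E.

(* <div u, phi> = - int u . grad phi *)
Definition distr_div u : testfun R d -> R := fun phi =>
  - \int[mu]_x (\sum_(i < d) u x ord0 i * partial i phi x).

(* A family w of d test functions is a field in D(R^d)^d. *)
Definition test_field (w : 'I_d -> testfun R d) : 'rV[R]_d -> 'rV[R]_d :=
  fun x => \row_i w i x.

Definition test_div (w : 'I_d -> testfun R d) : 'rV[R]_d -> R :=
  fun x => \sum_(i < d) partial i (w i) x.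

Definition TV v : \bar R :=
  ereal_sup [set (\int[mu]_x (v x * test_div w x))%:E |
    w in [set w : 'I_d -> testfun R d | (Linfty_norm (test_field w) <= 1)%E]].

Definition in_BV v : Prop :=
  mu.-integrable [set: 'rV[R]_d] (EFin \o v) /\ (TV v < +oo)%E.

End vector_fields.

(* A Banach space of distributions Y that is the dual of a normed space Z
   containing D(R^d) (through dds_test).  The pairing <y, z> identifies Y
   isometrically with the whole topological dual of Z, test functions suffice
   to compute the norm of Y, and each y acts on test functions as a
   distribution; by dds_norm that distribution determines y. *)
Record dual_distribution_space (R : realType) (d : nat) := {
  dds_carrier :> completeNormedModType R; (* Y *)
  dds_predual : normedModType R; (* Z *)
  dds_test : {linear testfun R d -> dds_predual};
  dds_test_inj : injective dds_test;
  dds_pair : dds_carrier -> dds_predual -> R;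
  dds_pair_linear : forall z, scalar (dds_pair ^~ z);
  dds_pair_dual : forall y, is_dual (dds_pair y);
  dds_pair_surj : forall L : dds_predual -> R, is_dual L ->
    exists y, dds_pair y = L;
  dds_pair_norm : forall y, `|y|%:E = dual_norm (dds_pair y);
  dds_norm : forall y, `|y|%:E =
    ereal_sup [set (dds_pair y (dds_test phi))%:E |
      phi in [set phi : testfun R d | `|dds_test phi| <= 1]];
  dds_distribution : forall y,
    is_distribution (fun phi => dds_pair y (dds_test phi)) }.

Section hierarchical.
Context (R : realType) (d : nat) (Y : dual_distribution_space R d).
Local Notation mu := (lebesgue_rV R d).

Definition to_distribution (y : Y) : testfun R d -> R :=
  fun phi => dds_pair y (dds_test Y phi).

(* J v is the element of Y' that v : BV stands for.  It is compatible with the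
   duality of distributions on either side: if v is a test function it is the
   action of y on v, and if y is a test function psi it is the integral of
   v * psi. *)
Definition BV_embedded_in_dual (beta : R) : Prop :=
  exists J : ('rV[R]_d -> R) -> Y -> R,
  [/\ forall v, in_BV v -> is_dual (J v),
      forall (a : R) v w, in_BV v -> in_BV w ->
        J (a *: v + w) = a *: J v + J w,
      forall (phi : testfun R d) y, J phi y = to_distribution y phi,
      forall v y (psi : testfun R d), in_BV v ->
        to_distribution y = (fun phi => \int[mu]_x (psi x * phi x)) ->
        J v y = \int[mu]_x (v x * psi x)
    & forall v, in_BV v -> (dual_norm (J v) <= beta%:E * TV v)%E].

(* The norm of Y extended to all distributions: at most one y represents T, and
   the infimum of the empty set is +oo when T is not in Y. *)
Definition Ynorm (T : testfun R d -> R) : \bar R :=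
  ereal_inf [set `|y|%:E | y in [set y : Y | to_distribution y = T]].

Definition calV (lam : R) (r : testfun R d -> R) (u : 'rV[R]_d -> 'rV[R]_d)
    : \bar R :=
  (Linfty_norm u + lam%:E * Ynorm (r - distr_div u)%R ^+ 2)%E.

Definition is_minimizer (F : ('rV[R]_d -> 'rV[R]_d) -> \bar R) u : Prop :=
  in_Linfty u /\ forall v, in_Linfty v -> (F u <= F v)%E.

End hierarchical.

(* Main.v *)
Require Import Defs.
From HB Require Import structures.
From mathcomp Require Import all_boot all_order all_algebra.
From mathcomp Require Import all_classical all_reals all_analysis.
From mathcomp Require Import measurable_realfun ess_sup_inf.
From mathcomp Require Import ring lra.
Set Implicit Arguments.
Unset Strict Implicit.
Unset Printing Implicit Defensive.
Import Order.TTheory GRing.Theory Num.Theory.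
Import numFieldNormedType.Exports.
Local Open Scope classical_set_scope.
Local Open Scope ring_scope.

(* For y in Y, the embedding of BV gives |<y, phi>| <= beta |y| int |grad phi|
   for test functions phi.  Hence grad phi |-> - <y, phi> is bounded for the L^1
   norm; it extends by Hahn-Banach, and the extension is integration against a
   bounded field h, so that div h = y and |h| <= beta |y|.

   Let y be the residual left by a minimizer u of
   |u| + lambda |r - div u|^2, and let div h = y as above.  Comparing u with
   u + e h, whose residual is (1 - e) y, gives
   lambda (2 - e) |y| <= beta, hence |y| <= beta / (2 lambda).  With
   lambda_j = beta 2^(j-1) / |f| this reads |r_j| <= |f| / 2^j, and
   V_j(u_j) <= V_j(0) gives |u_j| <= lambda_j |r_(j-1)|^2 <= beta |f| / 2^(j-1),
   a geometric series with sum 2 beta |f|. *)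

(** * Hahn-Banach *)

(** Lebesgue measure on R^d is infinite, whereas the Radon-Nikodym argument behind the L^1 duality
    asks for finite charges. A positive integrable weight [rho], a Gaussian, repairs this: the
    functional is placed on the fields [rho^-1 grad phi], whose [rho]-weighted L^1 norm is the plain
    L^1 norm of [grad phi]; they are bounded because [phi] has compact support. Its values are
    prescribed on these fields only, which is why Hahn-Banach is set up for graphs and for a bound
    that is sublinear on bounded fields. Estimating [h] through the functional on vector fields, not
    through its components, keeps the constant [beta] independent of the dimension.

    For the minimizers, the finite cost of the field 0 puts each residual back into Y, so that the
    iteration can continue there. The field [h] is chosen to rescale the residual, which turns the
    comparison into an inequality in the single real variable e. The equation reaches the limit one
    test function at a time: [div] is bounded from L^infinity, and the residuals tend to 0 in Y. *)

Section hahn_banach.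
Context (R : realType) (V : lmodType R) (D : set V) (p : V -> R).
Hypothesis D_lin : forall (a : R) x y, D x -> D y -> D (a *: x + y).
Hypothesis p_add : forall x y, D x -> D y -> p (x + y) <= p x + p y.
Hypothesis p_scale : forall (a : R) x, 0 <= a -> D x -> p (a *: x) = a * p x.

(* Partial functionals are represented by their graphs; domination by [p] makes
   a linear graph single-valued, since both [r <= p 0] and [- r <= p 0] hold
   for every value [r] at [0]. *)
Definition dominated_graph (G : set (V * R)) : Prop :=
  (forall a x r y s, G (x, r) -> G (y, s) -> G (a *: x + y, a * r + s)) /\
  (forall x r, G (x, r) -> D x /\ r <= p x).

Lemma dominated_graph_fun G x r s :
  dominated_graph G -> G (x, r) -> G (x, s) -> r = s.
Proof.
move=> [Glin Gp] Gr Gs.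
have D0 : D (0 : V) by have := D_lin (- 1) (Gp _ _ Gr).1 (Gp _ _ Gr).1;
  rewrite scaleN1r addNr.
have p0 : p 0 = 0 by have := p_scale (lexx 0) D0; rewrite scale0r mul0r.
have rs := (Gp _ _ (Glin (-1) _ _ _ _ Gr Gs)).2.
have sr := (Gp _ _ (Glin (-1) _ _ _ _ Gs Gr)).2.
rewrite scaleN1r addNr p0 in rs; rewrite scaleN1r addNr p0 in sr.
by apply/eqP; rewrite eq_le; apply/andP; split; lra.
Qed.

(** The value [c] at [x0] must lie above every [s - p (y - x0)] and below every [p (x + x0) - r].
    The former never exceed the latter because [r + s <= p (x + y)], so their supremum works, and
    rescaling reduces all multiples of [x0] to these two inequalities. There is no case for [x0]
    already in the domain of [G]: domination alone makes [G'] single-valued. *)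
Lemma dominated_graph_extend G x0 : G (0, 0) -> dominated_graph G -> D x0 ->
  exists G', [/\ dominated_graph G', G `<=` G' & exists r, G' (x0, r)].
Proof.
move=> G0 [Glin Gp] Dx0.
pose A := [set z.2 - p (z.1 - x0) | z in G].
have Gscale a x r : G (x, r) -> G (a *: x, a * r).
  by move=> Gxr; have := Glin a _ _ _ _ Gxr G0; rewrite !addr0.
have DB x : D x -> D (x - x0).
  by move=> Dx; rewrite addrC -scaleN1r; exact: D_lin.
have DA x : D x -> D (x + x0).
  by move=> Dx; rewrite -[x]scale1r; exact: D_lin.
have Aub x r : G (x, r) -> ubound A (p (x + x0) - r).
  move=> Gxr _ [[y s] Gys <-] /=.
  have [Dx _] := Gp _ _ Gxr; have [Dy _] := Gp _ _ Gys.
  have [_ pxy] := Gp _ _ (Glin 1 _ _ _ _ Gxr Gys).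
  have := p_add (DB _ Dy) (DA _ Dx).
  have -> : y - x0 + (x + x0) = 1 *: x + y.
    by rewrite scale1r addrACA [- x0 + x0]addNr addr0 addrC.
  lra.
have A0 : A !=set0 by exists (0 - p (0 - x0)); exists (0, 0).
have hA : has_ubound A by exists (p (0 + x0) - 0); exact: Aub.
pose c := sup A.
have cub x r : G (x, r) -> r + c <= p (x + x0).
  by move=> /Aub /(ge_sup A0); rewrite -/c; lra.
have clb x r : G (x, r) -> r - c <= p (x - x0).
  move=> Gxr; have : A (r - p (x - x0)) by exists (x, r).
  by move=> /(ub_le_sup hA); rewrite -/c; lra.
pose G' := [set z : V * R | exists t, G (z.1 - t *: x0, z.2 - t * c)].
exists G'; split.
- split=> [a x r y s [t /= Gt] [t' /= Gt']|x r [t /= Gt]].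
    exists (a * t + t') => /=.
    have := Glin a _ _ _ _ Gt Gt'.
    rewrite scalerBr scalerDl scalerA opprD addrACA.
    by have -> : a * (r - t * c) + (s - t' * c) = a * r + s - (a * t + t') * c
      by ring.
  split.
    by rewrite -(subrK (t *: x0) x) addrC; apply: D_lin => //;
      exact: (Gp _ _ Gt).1.
  have [t0|t0|t0] := ltgtP t 0.
  + have tn : 0 < - t by rewrite oppr_gt0.
    have Gt' := Gscale (- t)^-1 _ _ Gt.
    have := clb _ _ Gt'; rewrite -(@ler_pM2l _ (- t))// -p_scale ?(ltW tn)//.
      rewrite (scalerBr (- t)) (scalerA (- t)) mulfV ?gt_eqF// scale1r scaleNr.
      rewrite opprK subrK.
      by rewrite (mulrBr (- t)) (mulrA (- t)) mulfV ?gt_eqF// mul1r; lra.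
    by apply: DB; exact: (Gp _ _ Gt').1.
  + have Gt' := Gscale t^-1 _ _ Gt.
    have := cub _ _ Gt'; rewrite -(@ler_pM2l _ t)// -p_scale ?(ltW t0)//.
      rewrite (scalerDr t) (scalerA t) mulfV ?gt_eqF// scale1r subrK.
      by rewrite (mulrDr t) (mulrA t) mulfV ?gt_eqF// mul1r; lra.
    by apply: DA; exact: (Gp _ _ Gt').1.
  + have := (Gp _ _ Gt).2; rewrite t0 scale0r mul0r !subr0; exact.
- by move=> [x r] Gxr; exists 0; rewrite /= scale0r mul0r !subr0.
- by exists c, 1; rewrite /= scale1r mul1r !subrr.
Qed.

(** Everything is confined to [D] because the intended [p] is an integral, for which additivity
    requires integrable integrands. *)
Theorem hahn_banach (G0 : set (V * R)) : G0 (0, 0) -> dominated_graph G0 ->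
  exists L : V -> R,
    [/\ forall a x y, D x -> D y -> L (a *: x + y) = a * L x + L y,
        forall x, D x -> L x <= p x
      & forall x r, G0 (x, r) -> L x = r].
Proof.
move=> G00 hG0.
(* Adjoining [G0] inside the predicate makes it hold for the union of the empty chain. *)
have [|M [hM maxM]] := @Zorn_bigcup _ [set A | dominated_graph (A `|` G0)].
  move=> F FP Ftot; split=> [a x r y s|x r [[X FX Xxr]|]]; last 2 first.
  - by apply: (FP X FX).2; left.
  - exact: hG0.2.
  have step X Y : F X -> F Y -> X `<=` Y -> (X `|` G0) (x, r) ->
      (Y `|` G0) (y, s) \/ (X `|` G0) (y, s) ->
      ((\bigcup_(X in F) X) `|` G0) (a *: x + y, a * r + s).
    move=> FX FY XY Xx Yy.
    have : (Y `|` G0) (a *: x + y, a * r + s).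
      apply: (FP Y FY).1; first by case: Xx; [left; exact: XY|right].
      by case: Yy => // -[|]; [left; exact: XY|right].
    by case=> [Yy'|]; [left; exists Y|right].
  move=> [[X FX Xx]|Gx] [[Y FY Yy]|Gy].
  - have [XY|YX] := Ftot _ _ FX FY.
      by apply: (step X Y) => //; left => //; left.
    have : (X `|` G0) (a *: x + y, a * r + s).
      by apply: (FP X FX).1; left => //; exact: YX.
    by case; [left; exists X|right].
  - by apply: (step X X) => //; left => //; right.
  - by apply: (step Y Y) => //; [right|left; left].
  - by right; exact: hG0.1.
pose G := M `|` G0.
have Gtot x : D x -> exists r, G (x, r).
  move=> Dx; apply: contrapT => Gx.
  have [|G' [hG' GG' [r G'x]]] := @dominated_graph_extend G x _ hM Dx.
    by right.
  apply: (maxM G').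
    split; last by move=> /(_ _ G'x) Mx; apply: Gx; exists r; left.
    by move=> z Mz; apply: GG'; left.
  by rewrite /= setUidl// => z G0z; apply: GG'; right.
pose L x := xget 0 [set r | G (x, r)].
have GL x : D x -> G (x, L x).
  by move=> /Gtot[r Gr]; rewrite /L; case: xgetP => [? -> //|/(_ r)].
exists L; split=> [a x y Dx Dy|x Dx|x r G0x].
- apply: (dominated_graph_fun hM (GL _ (D_lin a Dx Dy))).
  by apply: hM.1; exact: GL.
- by have [] := hM.2 _ _ (GL _ Dx).
- have Gx : G (x, r) by right.
  by apply: (dominated_graph_fun hM _ Gx); apply: GL; have [] := hM.2 _ _ Gx.
Qed.

End hahn_banach.

(** * Bounded functionals on weighted L^1 *)

Section bounded_measurable.
Context d (T : measurableType d) (R : realType) (mu : {measure set T -> \bar R}).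
Implicit Types (k g h : T -> R).

(** The bound holds at every point, so the notion involves no measure; multiplication by such a
    function preserves integrability for every measure. *)
Definition bounded_measurable g : Prop :=
  measurable_fun [set: T] g /\ exists M, forall x, `|g x| <= M.

Lemma bounded_measurable_cst (c : R) : bounded_measurable (cst c).
Proof. by split; [exact: measurable_cst|exists `|c|]. Qed.

Lemma bounded_measurable0 : bounded_measurable (0 : T -> R).
Proof. exact: bounded_measurable_cst. Qed.

Lemma bounded_measurable_indic (A : set T) :
  measurable A -> bounded_measurable (\1_A).
Proof.
move=> mA; split; first exact: measurable_indic.
by exists 1 => x; rewrite indicE; case: (x \in A); rewrite ?normr1 ?normr0.
Qed.

Lemma bounded_measurable_lin (a : R) g h :
  bounded_measurable g -> bounded_measurable h ->
  bounded_measurable (a *: g + h).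
Proof.
move=> [mg [M Mg]] [mh [N Nh]]; split.
  by apply: measurable_funD => //; exact: measurable_funM.
exists (`|a| * M + N) => x; rewrite (le_trans (ler_normD _ _))// lerD//.
by rewrite normrM ler_wpM2l.
Qed.

Lemma bounded_measurable_sum I (s : seq I) (F : I -> T -> R) :
  (forall i, bounded_measurable (F i)) ->
  bounded_measurable (fun x => \sum_(i <- s) F i x).
Proof.
move=> bF; elim: s => [|i s IH].
  by under eq_fun do rewrite big_nil; exact: bounded_measurable_cst.
under eq_fun do rewrite big_cons.
by have := bounded_measurable_lin 1 (bF i) IH; rewrite scale1r.
Qed.

Lemma integrable_mul_bounded k g :
  mu.-integrable [set: T] (EFin \o k) -> bounded_measurable g ->
  mu.-integrable [set: T] (EFin \o (fun x => k x * g x)).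
Proof.
move=> ik [mg [M Mg]].
apply: (integrableMl measurableT ik mg).
by exists M; split; [exact: num_real|move=> N /ltW MN x _; exact: le_trans MN].
Qed.

Lemma Rintegral_mul_lin k (a : R) g h :
  mu.-integrable [set: T] (EFin \o k) ->
  bounded_measurable g -> bounded_measurable h ->
  \int[mu]_x (k x * (a *: g + h) x) =
  a * \int[mu]_x (k x * g x) + \int[mu]_x (k x * h x).
Proof.
move=> ik bg bh; rewrite -RintegralZl//; last exact: integrable_mul_bounded.
rewrite -RintegralD//; last exact: integrable_mul_bounded.
  apply: eq_Rintegral => x _.
  by rewrite (_ : (a *: g + h) x = a * g x + h x)//; ring.
have bag : bounded_measurable (a *: g).
  by have := bounded_measurable_lin a bg bounded_measurable0; rewrite addr0.
apply: eq_integrable (integrable_mul_bounded ik bag) => //= x _.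
by congr EFin; rewrite (_ : (a *: g) x = a * g x)//; ring.
Qed.

Lemma Rintegral_sum I (s : seq I) (F : I -> T -> R) :
  (forall i, mu.-integrable [set: T] (EFin \o F i)) ->
  \int[mu]_x (\sum_(i <- s) F i x) = \sum_(i <- s) \int[mu]_x F i x.
Proof.
move=> iF; elim: s => [|i s IH].
  under eq_Rintegral do rewrite big_nil.
  by rewrite Rintegral_cst// mul0r big_nil.
rewrite big_cons -IH -RintegralD//; last first.
  have := @integrable_sum _ _ _ mu [set: T] measurableT _ s xpredT
    (fun i => EFin \o F i) (fun i _ => iF i).
  by apply: eq_integrable => // x _; rewrite /= sumEFin.
by apply: eq_Rintegral => x _; rewrite big_cons.
Qed.

Lemma cvg_Rintegral_mul k (g_ : nat -> T -> R) g (M : R) :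
  mu.-integrable [set: T] (EFin \o k) ->
  (forall n, measurable_fun [set: T] (g_ n)) -> measurable_fun [set: T] g ->
  (forall n x, `|g_ n x| <= M) ->
  (forall x, g_ n x @[n --> \oo] --> g x) ->
  \int[mu]_x (k x * g_ n x) @[n --> \oo] --> \int[mu]_x (k x * g x).
Proof.
move=> ik mg_ mg Mg g_g.
have mk : measurable_fun [set: T] k by apply/measurable_EFinP/(measurable_int mu).
(* The dominating constant is the absolute value of [M], since [M] may be negative when [T] is
   empty. *)
have M0 : 0 <= `|M| by [].
have iM : mu.-integrable [set: T] (EFin \o (fun x => `|k x| * `|M|)).
  apply: (@integrable_mul_bounded (fun x => `|k x|)).
    exact: integrable_norm.
  exact: bounded_measurable_cst.
have [|||//||] := @dominated_convergence _ _ _ mu [set: T] measurableT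
  (fun n => EFin \o (fun x => k x * g_ n x)) (EFin \o (fun x => k x * g x))
  (EFin \o (fun x => `|k x| * `|M|)).
- by move=> n; apply/measurable_EFinP/measurable_funM.
- by apply/measurable_EFinP/measurable_funM.
- apply: aeW => x _; apply: cvg_EFin; first by apply: nearW.
  by apply: cvgM; [exact: cvg_cst|exact: g_g].
- apply: aeW => x n _; rewrite /= lee_fin normrM ler_wpM2l//.
  by rewrite (le_trans (Mg n x)) ?ler_norm.
- move=> [ikg _]; rewrite -[X in _ --> X]fineK; last exact: integrable_fin_num.
  exact: fine_cvg.
Qed.

End bounded_measurable.

(** * Functionals bounded by a weighted L^1 norm *)

Section weighted_L1_dual.
Context d (T : measurableType d) (R : realType).
Variables (mu : {sigma_finite_measure set T -> \bar R}) (rho : T -> R) (C : R).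
Hypothesis rho_int : mu.-integrable [set: T] (EFin \o rho).
Implicit Types (g h : T -> R).

Import HBNNSimple.

Section scalar.
Variable b : (T -> R) -> R.
Hypothesis b_lin : forall a g h, bounded_measurable g -> bounded_measurable h ->
  b (a *: g + h) = a * b g + b h.
Hypothesis b_le : forall g, bounded_measurable g ->
  `|b g| <= C * \int[mu]_x (rho x * `|g x|).

Let bD g h : bounded_measurable g -> bounded_measurable h ->
  b (g + h) = b g + b h.
Proof. by move=> bg bh; have := b_lin 1 bg bh; rewrite scale1r mul1r. Qed.

Let b0 : b 0 = 0.
Proof.
have := bD (bounded_measurable0 T R) (bounded_measurable0 T R).
by rewrite addr0; lra.
Qed.

Let bZ a g : bounded_measurable g -> b (a *: g) = a * b g.
Proof.
by move=> bg; have := b_lin a bg (bounded_measurable0 T R); rewrite b0 !addr0.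
Qed.

Let bB g h : bounded_measurable g -> bounded_measurable h ->
  b (g - h) = b g - b h.
Proof.
move=> bg bh; have := b_lin (-1) bh bg.
by rewrite scaleN1r mulN1r addrC => ->; rewrite addrC.
Qed.

Let b_sum I (s : seq I) (F : I -> T -> R) :
  (forall i, bounded_measurable (F i)) ->
  b (fun x => \sum_(i <- s) F i x) = \sum_(i <- s) b (F i).
Proof.
move=> bF; elim: s => [|i s IH].
  by rewrite big_nil; under eq_fun do rewrite big_nil; exact: b0.
rewrite big_cons -IH -bD//; last exact: bounded_measurable_sum.
by congr b; apply/funext => x; rewrite big_cons.
Qed.

(** The distance from [b (g_ n)] to [b g] is at most [C] times the integral of [rho * |g_ n - g|],
    which tends to 0 by dominated convergence. This gives both the countable additivity of [nu] and
    the passage from simple functions to bounded ones. *)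
Let b_cvg (g_ : nat -> T -> R) g (M : R) :
  (forall n, measurable_fun [set: T] (g_ n)) -> measurable_fun [set: T] g ->
  (forall n x, `|g_ n x| <= M) -> (forall x, `|g x| <= M) ->
  (forall x, g_ n x @[n --> \oo] --> g x) ->
  b (g_ n) @[n --> \oo] --> b g.
Proof.
move=> mg_ mg Mg_ Mg g_g.
have bg : bounded_measurable g by split => //; exists M.
have bg_ n : bounded_measurable (g_ n) by split => //; exists M.
have cvgI : C * \int[mu]_x (rho x * `|g_ n x - g x|) @[n --> \oo] --> C * 0.
  apply: cvgM; first exact: cvg_cst.
  have -> : 0 = \int[mu]_x (rho x * cst 0 x).
    by under eq_Rintegral do rewrite /= mulr0; rewrite Rintegral_cst// mul0r.
  apply: (@cvg_Rintegral_mul _ _ _ _ _ _ _ (M + M)) => //.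
  - by move=> n; apply: measurableT_comp => //; exact: measurable_funB.
  - move=> n x; rewrite normr_id (le_trans (ler_normB _ _))// lerD//.
  - move=> x; apply/norm_cvg0P; apply/subr_cvg0; exact: g_g.
apply/subr_cvg0/norm_cvg0P; rewrite mulr0 in cvgI.
apply: (squeeze_cvgr _ (cvg_cst 0) cvgI); apply: nearW => n.
by rewrite normr_ge0/= -bB// b_le//; have := bounded_measurable_lin (-1) bg (bg_ n);
  rewrite scaleN1r addrC.
Qed.

Let nu (A : set T) : \bar R := (b (\1_A))%:E.

Let nu_sigma_additive : semi_sigma_additive nu.
Proof.
move=> F mF tF mUF; rewrite /nu.
under eq_fun do rewrite sumEFin.
apply: cvg_EFin; first exact: nearW.
rewrite /comp/=.
under eq_fun do rewrite -(b_sum _ (fun i => bounded_measurable_indic R (mF i))).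
(* Disjointness makes each partial sum an indicator, so the constant 1 bounds them all. *)
have partialE n x :
    \sum_(0 <= i < n) \1_(F i) x = \1_(\big[setU/set0]_(i < n) F i) x :> R.
  elim: n => [|n IH]; first by rewrite big_geq// big_ord0 indic0.
  rewrite big_nat_recr//= IH big_ord_recr/= !indicE in_setU.
  have [xn|xn] := boolP (x \in F n); last by rewrite orbF addr0.
  rewrite orbT; have [|_] := boolP (x \in \big[setU/set0]_(i < n) F i).
    rewrite inE -bigcup_mkord => -[k /= kn Fkx].
    have /= := tF k n Logic.I Logic.I (ex_intro _ x (conj Fkx (set_mem xn))).
    by move=> kE; rewrite kE ltnn in kn.
  by rewrite add0r.
apply: (b_cvg (M := 1)) => [n||n x|x|x].
- by apply: measurable_sum => i; exact: measurable_indic.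
- exact: measurable_indic.
- by rewrite partialE indicE; case: (_ \in _); rewrite ?normr1 ?normr0.
- by rewrite indicE; case: (_ \in _); rewrite ?normr1 ?normr0.
have : (\sum_(0 <= i < n) (\1_(F i) x)%:E)%E @[n --> \oo] -->
    (\1_(\bigcup_n F n) x : R)%:E.
  rewrite indic_bigcup//; apply: is_cvg_nneseries => n _ _.
  by rewrite lee_fin indicE.
by move=> /fine_cvg; under eq_cvg do rewrite /= sumEFin.
Qed.

(** The bound by an integral makes [nu] vanish on [mu]-null sets, so it has a Radon-Nikodym density
    [k]. The formula spreads from indicators to simple functions by linearity, then to nonnegative
    functions by [b_cvg]. The density [k] still contains the weight. *)
Lemma weighted_L1_dual_scalar : exists k : T -> R,
  mu.-integrable [set: T] (EFin \o k) /\
  forall g, bounded_measurable g -> b g = \int[mu]_x (k x * g x).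
Proof.
have nu0 : nu set0 = 0%E by rewrite /nu indic0 b0.
have nufin A : measurable A -> nu A \is a fin_num by [].
pose nuC : {charge set T -> \bar R} :=
  HB.pack nu (isCharge.Build _ _ _ nu nu0 nufin nu_sigma_additive).
have numu : nuC `<< mu.
  apply/null_content_dominatesP => A mA muA0.
  suff bA : b (\1_A) = 0 by rewrite /= /nu bA.
  apply/eqP; rewrite -normr_le0.
  have := b_le (bounded_measurable_indic R mA).
  suff -> : \int[mu]_x (rho x * `|\1_A x|) = 0 by rewrite mulr0.
  under eq_Rintegral do rewrite ger0_norm ?indicE// mulrC -indicE.
  have -> : (fun x => \1_A x * rho x) = rho \_ A.
    apply/funext => x; rewrite patchE indicE.
    by case: (x \in A); rewrite ?mul1r ?mul0r.
  rewrite -Rintegral_mkcond /Rintegral.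
  rewrite null_set_integral//=; apply: measurable_funTS.
  exact: measurable_int rho_int.
pose k x := fine (Radon_Nikodym nuC mu x).
have kE : EFin \o k = Radon_Nikodym nuC mu.
  by apply/funext => x; rewrite /= fineK// Radon_Nikodym_fin_num.
have ik : mu.-integrable [set: T] (EFin \o k).
  by rewrite kE; exact: Radon_Nikodym_integrable.
exists k; split => //.
have k_indic A : measurable A -> b (\1_A) = \int[mu]_x (k x * \1_A x).
  move=> mA; have := Radon_Nikodym_integral numu mA.
  rewrite -kE integral_mkcond => /(congr1 fine) /= ->.
  congr fine; apply: eq_integral => x _; rewrite patchE indicE.
  by case: (x \in A); rewrite ?mulr1 ?mulr0.
have k_sum I (s : seq I) (F : I -> T -> R) : (forall i, bounded_measurable (F i)) ->
    \int[mu]_x (k x * \sum_(i <- s) F i x) = \sum_(i <- s) \int[mu]_x (k x * F i x).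
  move=> bF; elim: s => [|i s IH].
    under eq_Rintegral do rewrite big_nil mulr0.
    by rewrite Rintegral_cst// mul0r big_nil.
  rewrite big_cons -IH -[X in X + _]mul1r -Rintegral_mul_lin//; last first.
    exact: bounded_measurable_sum.
  by apply: eq_Rintegral => x _; rewrite big_cons scale1r.
have kD g h : bounded_measurable g -> bounded_measurable h ->
    \int[mu]_x (k x * (g + h) x) =
    \int[mu]_x (k x * g x) + \int[mu]_x (k x * h x).
  by move=> bg bh; have := Rintegral_mul_lin 1 ik bg bh; rewrite scale1r mul1r.
have kZ a g : bounded_measurable g ->
    \int[mu]_x (k x * (a *: g) x) = a * \int[mu]_x (k x * g x).
  move=> bg; have := Rintegral_mul_lin a ik bg (bounded_measurable0 T R).
  rewrite addr0 => ->; under [X in _ + X]eq_Rintegral do rewrite mulr0.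
  by rewrite Rintegral_cst// mul0r addr0.
have k_fimfun (f : {nnsfun T >-> R}) : b f = \int[mu]_x (k x * f x).
  have mf y : measurable (f @^-1` [set y]).
    by rewrite -[X in measurable X]setTI; exact: measurable_funP.
  have bf y : bounded_measurable (\1_(f @^-1` [set y]) : T -> R).
    exact: bounded_measurable_indic.
  have byf y : bounded_measurable (y *: \1_(f @^-1` [set y]) : T -> R).
    by have := bounded_measurable_lin y (bf y) (bounded_measurable0 T R);
      rewrite addr0.
  have -> : (f : T -> R) = fun x => \sum_(y <- finmap.enum_fset (fset_set (range f)))
      (y *: \1_(f @^-1` [set y]) : T -> R) x.
    by apply/funext => x; rewrite fimfunE fsbig_finite.
  by rewrite b_sum// k_sum//; apply: eq_bigr => y _; rewrite bZ// kZ// k_indic.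
have k_pos g : bounded_measurable g -> (forall x, 0 <= g x) ->
    b g = \int[mu]_x (k x * g x).
  move=> [mg [M Mg]] g0.
  have mEg : measurable_fun [set: T] (EFin \o g) by exact/measurable_EFinP.
  pose g_ := nnsfun_approx measurableT mEg.
  have Eg0 x : [set: T] x -> (0 <= (EFin \o g) x)%E by rewrite lee_fin.
  have Mg_ n x : `|g_ n x| <= M.
    rewrite ger0_norm//; have := @le_approx _ _ _ _ _ n x Eg0 Logic.I.
    rewrite -nnsfun_approxE lee_fin => /le_trans; apply.
    by rewrite (le_trans (ler_norm _))//.
  have cvg_g_ x : g_ n x @[n --> \oo] --> g x.
    have := cvg_nnsfun_approx measurableT mEg Eg0 (Logic.I : [set: T] x).
    by move=> /fine_cvg.
  have c1 := b_cvg (g_ := fun n => g_ n) (fun n => measurable_funP (g_ n))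
    mg Mg_ Mg cvg_g_.
  have := cvg_Rintegral_mul ik (fun n => measurable_funP (g_ n)) mg Mg_ cvg_g_.
  under eq_fun do rewrite -k_fimfun.
  exact: cvg_unique c1.
(* A signed [g] becomes nonnegative after adding its bound [M]. *)
move=> g bg; have [_ [M Mg]] := bg.
have bM := @bounded_measurable_cst _ T R M.
have bgM : bounded_measurable (g + cst M).
  by have := bounded_measurable_lin 1 bg bM; rewrite scale1r.
have := bD bg bM; rewrite k_pos//; last first.
  move=> x; have := Mg x; rewrite ler_norml => /andP[+ _].
  by rewrite -lerBlDr sub0r.
rewrite (k_pos (cst M))//; last by move=> x /=; exact: le_trans (Mg x).
by rewrite kD//; lra.
Qed.

End scalar.
End weighted_L1_dual.

(** On nonnegative reals the inverse is the power with exponent -1, including at 0, where both are 0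
    by convention. *)
Lemma measurable_funV_ge0 d (T : measurableType d) (R : realType) (g : T -> R) :
  (forall x, 0 <= g x) -> measurable_fun [set: T] g ->
  measurable_fun [set: T] (fun x => (g x)^-1).
Proof.
move=> g0 mg; under eq_fun do rewrite -powR_inv1//.
exact: (measurableT_comp (measurable_powR _)).
Qed.

(** * The Euclidean norm on row vectors *)

Section euclid_norm.
Context (R : realType) (n : nat).
Implicit Types x y : 'rV[R]_n.

Let sumsq_ge0 x : 0 <= \sum_(i < n) x ord0 i ^+ 2.
Proof. by apply: sumr_ge0 => i _; exact: sqr_ge0. Qed.

Lemma euclid_norm_ge0 x : 0 <= euclid_norm x.
Proof. exact: sqrtr_ge0. Qed.

Lemma euclid_norm_sqr x : euclid_norm x ^+ 2 = \sum_(i < n) x ord0 i ^+ 2.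
Proof. by rewrite sqr_sqrtr. Qed.

Lemma euclid_normZ (a : R) x : euclid_norm (a *: x) = `|a| * euclid_norm x.
Proof.
rewrite /euclid_norm -sqrtr_sqr -sqrtrM ?sqr_ge0// mulr_sumr.
by congr Num.sqrt; apply: eq_bigr => i _; rewrite mxE exprMn.
Qed.

Lemma le_euclid_norm x i : `|x ord0 i| <= euclid_norm x.
Proof.
rewrite /euclid_norm -sqrtr_sqr ler_wsqrtr// (bigD1 i)//= lerDl.
by apply: sumr_ge0 => j _; exact: sqr_ge0.
Qed.

Lemma euclid_norm_eq0 x : euclid_norm x = 0 -> x = 0.
Proof.
move=> x0; apply/rowP => i; rewrite mxE; apply/eqP; rewrite -normr_le0 -x0.
exact: le_euclid_norm.
Qed.

Lemma euclid_norm0 : euclid_norm (0 : 'rV[R]_n) = 0.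
Proof. by rewrite -[0](scale0r 0) euclid_normZ normr0 mul0r. Qed.

Lemma euclid_norm_delta i : euclid_norm (delta_mx ord0 i : 'rV[R]_n) = 1.
Proof.
rewrite /euclid_norm (bigD1 i)//= mxE !eqxx expr1n big1 ?addr0 ?sqrtr1// => j ji.
by rewrite mxE (negbTE ji) andbF expr0n.
Qed.

(** Cauchy-Schwarz: expanding the nonnegative sum of [(b x_i - a y_i)^2] and dividing by [2 a b],
    where [a] and [b] are the two norms. *)
Lemma dot_le_euclid_norm x y :
  \sum_(i < n) x ord0 i * y ord0 i <= euclid_norm x * euclid_norm y.
Proof.
set a := euclid_norm x; set b := euclid_norm y.
have [a0|a0] := eqVneq a 0.
  by rewrite (euclid_norm_eq0 a0) a0 mul0r big1// => i _; rewrite mxE mul0r.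
have [b0|b0] := eqVneq b 0.
  by rewrite (euclid_norm_eq0 b0) b0 mulr0 big1// => i _; rewrite mxE mulr0.
have ab : 0 < a * b.
  by rewrite mulr_gt0// lt_neqAle eq_sym ?a0 ?b0 euclid_norm_ge0.
have : 0 <= \sum_(i < n) (b * x ord0 i - a * y ord0 i) ^+ 2.
  by apply: sumr_ge0 => i _; exact: sqr_ge0.
rewrite (_ : \sum_(i < n) _ = b ^+ 2 * \sum_(i < n) x ord0 i ^+ 2 +
    a ^+ 2 * \sum_(i < n) y ord0 i ^+ 2 -
    2 * (a * b) * \sum_(i < n) x ord0 i * y ord0 i).
  rewrite -!euclid_norm_sqr -/a -/b => ineq.
  by rewrite -(ler_pM2l ab); lra.
by rewrite !mulr_sumr -big_split/= -sumrB; apply: eq_bigr => i _; ring.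
Qed.

Lemma euclid_normD x y : euclid_norm (x + y) <= euclid_norm x + euclid_norm y.
Proof.
rewrite -(ler_pXn2r (ltn0Sn 1)) ?nnegrE ?addr_ge0 ?euclid_norm_ge0//.
rewrite sqrrD !euclid_norm_sqr.
have -> : \sum_(i < n) (x + y) ord0 i ^+ 2 = \sum_(i < n) x ord0 i ^+ 2 +
    2 * (\sum_(i < n) x ord0 i * y ord0 i) + \sum_(i < n) y ord0 i ^+ 2.
  rewrite mulr_sumr -!big_split/=; apply: eq_bigr => i _; rewrite mxE; ring.
by have := dot_le_euclid_norm x y; lra.
Qed.

Lemma euclid_normN x : euclid_norm (- x) = euclid_norm x.
Proof. by rewrite -scaleN1r euclid_normZ normrN1 mul1r. Qed.

Lemma measurable_euclid_norm d (T : measurableType d) (u : T -> 'rV[R]_n) :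
  (forall i, measurable_fun [set: T] (fun t => u t ord0 i)) ->
  measurable_fun [set: T] (fun t => euclid_norm (u t)).
Proof.
move=> mu; have msqrt : measurable_fun [set: R] (@Num.sqrt R).
  by apply: continuous_measurable_fun; exact: sqrt_continuous.
apply: (measurableT_comp msqrt); apply: measurable_sum => i.
exact: measurable_funX.
Qed.

End euclid_norm.

(** * Vector fields and the weighted L^1 norm *)

Section weighted_vector_dual.
Context d (T : measurableType d) (R : realType) (n : nat).
Variables (mu : {sigma_finite_measure set T -> \bar R}) (rho : T -> R) (C : R).
Hypothesis C_ge0 : 0 <= C.
Hypothesis rho_gt0 : forall x, 0 < rho x.
Hypothesis rho_int : mu.-integrable [set: T] (EFin \o rho).
Implicit Types (psi : T -> 'rV[R]_n).

Definition bounded_field psi : Prop :=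
  forall i, bounded_measurable (fun x => psi x ord0 i).

Lemma bounded_field_lin (a : R) psi phi :
  bounded_field psi -> bounded_field phi -> bounded_field (a *: psi + phi).
Proof.
move=> bpsi bphi i; have := bounded_measurable_lin a (bpsi i) (bphi i).
congr bounded_measurable; apply/funext => x.
by rewrite (_ : (a *: psi + phi) x = a *: psi x + phi x)// !mxE.
Qed.

Lemma bounded_field0 : bounded_field (0 : T -> 'rV[R]_n).
Proof.
move=> i; have := bounded_measurable0 T R.
by congr bounded_measurable; apply/funext => x; rewrite mxE.
Qed.

Lemma bounded_measurable_euclid_norm psi :
  bounded_field psi -> bounded_measurable (fun x => euclid_norm (psi x)).
Proof.
move=> bpsi; split; first by apply: measurable_euclid_norm => i; have [] := bpsi i.
have /choice[M Mpsi] : forall i, exists M, forall x, `|psi x ord0 i| <= M.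
  by move=> i; have [_] := bpsi i.
exists (Num.sqrt (\sum_(i < n) M i ^+ 2)) => x.
rewrite ger0_norm ?euclid_norm_ge0// ler_wsqrtr// ler_sum// => i _.
by rewrite -real_normK ?num_real// lerXn2r ?nnegrE// (le_trans _ (Mpsi i x)).
Qed.

Definition axis_field i (g : T -> R) : T -> 'rV[R]_n :=
  fun x => g x *: delta_mx ord0 i.

Lemma bounded_axis_field i g :
  bounded_measurable g -> bounded_field (axis_field i g).
Proof.
move=> bg j; under eq_fun do rewrite /axis_field !mxE eqxx/= mulrC.
have := bounded_measurable_lin (i == j)%:R bg (bounded_measurable0 T R).
by rewrite addr0 eq_sym.
Qed.

Section representation.
Variable L : (T -> 'rV[R]_n) -> R.
Hypothesis L_lin : forall a psi phi, bounded_field psi -> bounded_field phi ->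
  L (a *: psi + phi) = a * L psi + L phi.
Hypothesis L_le : forall psi, bounded_field psi ->
  L psi <= C * \int[mu]_x (rho x * euclid_norm (psi x)).

Let L0 : L 0 = 0.
Proof.
by have := L_lin 1 bounded_field0 bounded_field0; rewrite scale1r addr0; lra.
Qed.

Let bounded_fieldN psi : bounded_field psi -> bounded_field (- psi).
Proof.
move=> bpsi; have := bounded_field_lin (-1) bpsi bounded_field0.
by rewrite addr0 scaleN1r.
Qed.

Let L_norm_le psi : bounded_field psi ->
  `|L psi| <= C * \int[mu]_x (rho x * euclid_norm (psi x)).
Proof.
move=> bpsi; rewrite ler_norml L_le// andbT lerNl.
have := L_lin (-1) bpsi bounded_field0; rewrite addr0 L0 addr0 mulN1r => <-.
rewrite scaleN1r (le_trans (L_le (bounded_fieldN bpsi)))//.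
by under eq_Rintegral do rewrite fctE euclid_normN.
Qed.

Let bounded_field_sum I (s : seq I) (F : I -> T -> 'rV[R]_n) :
  (forall i, bounded_field (F i)) -> bounded_field (\sum_(i <- s) F i).
Proof.
move=> bF; elim/big_ind : _ => // [|f g bf bg]; first exact: bounded_field0.
by rewrite -[f]scale1r; exact: bounded_field_lin.
Qed.

Let L_sum I (s : seq I) (F : I -> T -> 'rV[R]_n) :
  (forall i, bounded_field (F i)) -> L (\sum_(i <- s) F i) = \sum_(i <- s) L (F i).
Proof.
move=> bF; elim: s => [|i s IH]; first by rewrite !big_nil.
rewrite !big_cons -IH -[F i]scale1r L_lin ?mul1r ?scale1r//.
exact: bounded_field_sum.
Qed.

Let L_axis psi : bounded_field psi ->
  L psi = \sum_(i < n) L (axis_field i (fun x => psi x ord0 i)).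
Proof.
move=> bpsi; rewrite -L_sum => [|i]; last exact: bounded_axis_field.
congr L; apply/funext => x; rewrite fct_sumE [LHS]row_sum_delta.
exact: eq_bigr.
Qed.

(* The weight makes the charges [A |-> L (\1_A e_i)] finite, which the
   Radon-Nikodym theorem requires. *)
Lemma weighted_vector_dual : exists h : T -> 'rV[R]_n,
  [/\ forall i, measurable_fun [set: T] (fun x => h x ord0 i),
      {ae mu, forall x, euclid_norm (h x) <= C}
    & forall psi, bounded_field psi ->
      L psi = \int[mu]_x (rho x * \sum_(i < n) h x ord0 i * psi x ord0 i)].
Proof.
have /choice[k Lk] : forall i, exists k : T -> R,
    mu.-integrable [set: T] (EFin \o k) /\
    forall g, bounded_measurable g ->
      L (axis_field i g) = \int[mu]_x (k x * g x).
  move=> i; apply: (@weighted_L1_dual_scalar _ _ _ mu rho C) => //.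
  - move=> a g h bg bh; rewrite -L_lin; try exact: bounded_axis_field.
    by congr L; apply/funext => x; rewrite /axis_field [LHS]scalerDl -scalerA.
  - move=> g bg; have := L_norm_le (bounded_axis_field i bg).
    by under eq_Rintegral do rewrite euclid_normZ euclid_norm_delta mulr1.
have mk i : measurable_fun [set: T] (k i).
  by apply/measurable_EFinP; apply: measurable_int (Lk i).1.
have mrho : measurable_fun [set: T] rho.
  by apply/measurable_EFinP; apply: measurable_int rho_int.
(* Dividing the weight out of the scalar densities [k i] gives the field that will be bounded. *)
have [h khE mh] : exists2 h : T -> 'rV[R]_n,
    forall i x, k i x = rho x * h x ord0 i &
    forall i, measurable_fun [set: T] (fun x => h x ord0 i).
  exists (fun x => \row_i ((rho x)^-1 * k i x)) => [i x|i].
    by rewrite mxE mulrA mulfV ?gt_eqF// mul1r.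
  under eq_fun do rewrite mxE; apply: measurable_funM => //.
  by apply: measurable_funV_ge0 => // x; exact: ltW.
have ikh i g : bounded_measurable g ->
    mu.-integrable [set: T] (EFin \o (fun x => k i x * g x)).
  by move=> bg; apply: integrable_mul_bounded => //; exact: (Lk i).1.
have Lh psi : bounded_field psi ->
    L psi = \int[mu]_x (rho x * \sum_(i < n) h x ord0 i * psi x ord0 i).
  move=> bpsi; rewrite L_axis//.
  under eq_bigr do rewrite (Lk _).2//.
  rewrite -Rintegral_sum//; last by move=> i; exact: ikh.
  apply: eq_Rintegral => x _; rewrite mulr_sumr; apply: eq_bigr => i _.
  by rewrite mulrA -khE.
exists h; split => //.
(* The scalar representations give no bound on [h]. The bound by [C] in Euclidean norm comes from
   applying [L_le] to a single vector field. *)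
pose N x := euclid_norm (h x).
have mN : measurable_fun [set: T] N by exact: measurable_euclid_norm.
pose E := [set x | C < N x].
have mE : measurable E.
  rewrite (_ : E = N @^-1` `]C, +oo[%classic).
    by rewrite -[X in measurable X]setTI; exact: mN.
  by apply/seteqP; split => x /=; rewrite in_itv/= andbT.
(* testing against the unit field in the direction of [h] on [E] *)
pose psi x := (\1_E x * (N x)^-1) *: h x.
have psi_le1 x : euclid_norm (psi x) <= \1_E x.
  rewrite euclid_normZ indicE normrM ger0_norm//.
  have [->|N0] := eqVneq (N x) 0; first by rewrite invr0 normr0 mulr0 mul0r.
  by rewrite -mulrA -/(N x) normfV ger0_norm ?euclid_norm_ge0// mulVf// mulr1.
have bpsi : bounded_field psi.
  move=> i; split.
    under eq_fun do rewrite mxE; apply: measurable_funM => //.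
    apply: measurable_funM; first exact: measurable_indic.
    by apply: measurable_funV_ge0 => // x; exact: euclid_norm_ge0.
  by exists 1 => x; rewrite (le_trans (le_euclid_norm _ _))// (le_trans (psi_le1 x)).
have iE : mu.-integrable [set: T] (EFin \o (fun x => rho x * \1_E x)).
  by apply: integrable_mul_bounded => //; exact: bounded_measurable_indic.
have psihE x : \sum_(i < n) h x ord0 i * psi x ord0 i = \1_E x * N x.
  under eq_bigr do rewrite mxE mulrCA -expr2.
  rewrite -mulr_sumr -euclid_norm_sqr -/(N x).
  have [->|N0] := eqVneq (N x) 0; first by rewrite expr0n/= !mulr0.
  by rewrite -mulrA expr2 mulKf.
have iEN : mu.-integrable [set: T] (EFin \o (fun x => rho x * (\1_E x * N x))).
  have := @integrable_sum _ _ _ mu [set: T] measurableT _ (index_enum 'I_n) xpredT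
    (fun i x => (k i x * psi x ord0 i)%:E) (fun i _ => ikh i _ (bpsi i)).
  apply: eq_integrable => //= x _; rewrite sumEFin -psihE; congr EFin.
  by rewrite mulr_sumr; apply: eq_bigr => i _; rewrite mulrA -khE.
have iEpsi : mu.-integrable [set: T]
    (EFin \o (fun x => rho x * euclid_norm (psi x))).
  by apply: integrable_mul_bounded => //; exact: bounded_measurable_euclid_norm.
have L_E : \int[mu]_x (rho x * (\1_E x * N x)) <= C * \int[mu]_x (rho x * \1_E x).
  have := L_le bpsi; rewrite Lh//; under eq_Rintegral do rewrite psihE.
  move=> /le_trans; apply; rewrite ler_wpM2l// le_Rintegral// => x _.
  by rewrite ler_pM2l.
(* On [E] this is [rho * (N - C) > 0], and it is 0 elsewhere. By [L_E] its integral is at most 0,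
   hence [F] vanishes almost everywhere and [E] is null. *)
pose F x := rho x * (\1_E x * N x) - C * (rho x * \1_E x).
have iCE : mu.-integrable [set: T] (EFin \o (fun x => C * (rho x * \1_E x))).
  exact: (integrableZl measurableT C iE).
have F_ge0 x : 0 <= F x.
  rewrite /F indicE; have [|_] := boolP (x \in E); last first.
    by rewrite mul0r !mulr0 subrr.
  rewrite inE /E/= mul1r mulr1 subr_ge0 mulrC => /ltW CN.
  by rewrite ler_wpM2l// ltW.
have iF : mu.-integrable [set: T] (EFin \o F).
  exact: (integrableB measurableT iEN iCE).
have F0 : (\int[mu]_x `|(F x)%:E|)%E = 0%E.
  under eq_integral do rewrite gee0_abs ?lee_fin//.
  apply/eqP; rewrite eq_le integral_ge0 ?andbT => [|x _]; last by rewrite lee_fin.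
  rewrite -[leLHS]fineK; last exact: integrable_fin_num.
  by rewrite lee_fin -/(Rintegral _ _ _) RintegralB// RintegralZl// subr_le0.
have := (ae_eq_integral_abs mu measurableT (measurable_int mu iF)).1 F0.
apply: filterS => x /(_ Logic.I) [] /eqP; rewrite /F indicE.
have [|] := boolP (x \in E); last first.
  by rewrite notin_setE /E/= => /negP; rewrite -leNgt.
rewrite inE /E/= => CN; rewrite mul1r mulr1 subr_eq0 mulrC.
by rewrite (inj_eq (mulIf _)) ?gt_eqF// eq_sym lt_eqF.
Qed.

End representation.
End weighted_vector_dual.

Section field_functional_representation.
Context d (T : measurableType d) (R : realType) (n : nat).
Variables (mu : {sigma_finite_measure set T -> \bar R}) (rho : T -> R) (C : R).
Hypothesis C_ge0 : 0 <= C.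
Hypothesis rho_gt0 : forall x, 0 < rho x.
Hypothesis rho_int : mu.-integrable [set: T] (EFin \o rho).
Local Notation p psi :=
  (C * \int[mu]_x (rho x * euclid_norm ((psi : T -> 'rV[R]_n) x))).

(** With a graph as datum, the values may be indexed by something other than the field itself, such
    as a test function; that they depend on the field alone follows from the bound. *)
Theorem field_functional_representation (G : set ((T -> 'rV[R]_n) * R)) :
  G (0, 0) ->
  (forall a psi r phi s, G (psi, r) -> G (phi, s) ->
     G (a *: psi + phi, a * r + s)) ->
  (forall psi r, G (psi, r) -> bounded_field psi /\ r <= p psi) ->
  exists h : T -> 'rV[R]_n,
  [/\ forall i, measurable_fun [set: T] (fun x => h x ord0 i),
      {ae mu, forall x, euclid_norm (h x) <= C}
    & forall psi r, G (psi, r) ->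
      r = \int[mu]_x (rho x * \sum_(i < n) h x ord0 i * psi x ord0 i)].
Proof.
move=> G0 Glin Gp.
have irho (psi : T -> 'rV[R]_n) : bounded_field psi ->
    mu.-integrable [set: T] (EFin \o (fun x => rho x * euclid_norm (psi x))).
  move=> bpsi; apply: integrable_mul_bounded => //.
  exact: bounded_measurable_euclid_norm.
have p_add psi phi : bounded_field psi -> bounded_field phi ->
    p (psi + phi) <= p psi + p phi.
  move=> bpsi bphi.
  have bD : bounded_field (psi + phi).
    by rewrite -[psi]scale1r; exact: bounded_field_lin.
  rewrite -mulrDr ler_wpM2l// -RintegralD//; try exact: irho.
  apply: le_Rintegral => //; first exact: irho.
    exact: (integrableD measurableT (irho _ bpsi) (irho _ bphi)).
  by move=> x _; rewrite -mulrDr ler_pM2l// euclid_normD.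
have p_scale (a : R) psi : 0 <= a -> bounded_field psi -> p (a *: psi) = a * p psi.
  move=> a0 bpsi; rewrite mulrCA; congr (_ * _); rewrite -RintegralZl//; last first.
    exact: irho.
  apply: eq_Rintegral => x _.
  by rewrite (_ : (a *: psi) x = a *: psi x)// euclid_normZ ger0_norm// mulrCA.
have [L [L_lin L_le LG]] := @hahn_banach R _ _ _ (@bounded_field_lin _ T R n)
  p_add p_scale G G0 (conj Glin Gp).
have [h [mh hC Lh]] := weighted_vector_dual C_ge0 rho_gt0 rho_int L_lin L_le.
exists h; split => // psi r Gpsi.
by rewrite -Lh -?(LG _ _ Gpsi)//; have [] := Gp _ _ Gpsi.
Qed.

End field_functional_representation.

(** * Integration on R^d *)

Lemma continuous_rV (R : realType) (S : topologicalType) n (phi : S -> 'rV[R]_n) :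
  (forall i, continuous (fun t => phi t ord0 i)) -> continuous phi.
Proof.
move=> cphi t A [P Pt PA].
have : \forall s \near t, forall i : 'I_n, P ord0 i (phi s ord0 i).
  by apply: filter_forall => i; apply: cphi; exact: Pt.
by apply: filterS => s Ps; apply: PA => i j; rewrite ord1.
Qed.

Lemma continuous_coord (R : realType) n (i : 'I_n) :
  continuous (fun x : 'rV[R]_n => x ord0 i).
Proof. exact: coord_continuous. Qed.

(** The sigma-algebra is generated by the coordinates, so an open set is written as a countable
    union of cubes with rational centres and radii [1/(k+1)]. *)
Lemma open_measurable_rV (R : realType) n (A : set 'rV[R]_n) :
  open A -> measurable A.
Proof.
move=> oA.
pose U (qk : 'rV[rat]_n * nat) : set 'rV[R]_n :=
  [set y | forall i, `|ratr (qk.1 ord0 i) - y ord0 i| < (qk.2.+1%:R)^-1].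
have mU qk : measurable (U qk).
  have -> : U qk = \bigcap_(i in [set: 'I_n]) (fun y : 'rV[R]_n => y ord0 i) @^-1`
      (ball (ratr (qk.1 ord0 i) : R) (qk.2.+1%:R)^-1).
    by apply/seteqP; split=> [y Uy i _|y Uy i]; exact: Uy.
  apply: fin_bigcap_measurable => [|i _]; first exact: finite_finset.
  have := @measurable_coord R n i measurableT _
    (measurable_ball (ratr (qk.1 ord0 i) : R) (qk.2.+1%:R)^-1).
  by rewrite setTI.
(* Cubes that leave [A] are replaced by the empty set, so that the union runs over the whole
   countable type. *)
pose F qk := if `[< U qk `<=` A >] then U qk else set0.
have -> : A = \bigcup_qk F qk.
  apply/seteqP; split=> [x Ax|x [qk _]]; last first.
    by rewrite /F; case: asboolP => // UA Ux; exact: UA.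
  have /nbhs_ballP[e /= e0 xeA] : nbhs x A by exact: open_nbhs_nbhs.
  (* Half of [e], because a point of the cube is compared with [x] through the rational centre. *)
  have [k ke] : exists k : nat, (k.+1%:R)^-1 < e / 2 :> R.
    have e2 : 0 < e / 2 by rewrite divr_gt0.
    exists (Num.truncn (e / 2)^-1).
    by rewrite invf_plt ?posrE// truncnS_gt.
  have /choice[q qx] : forall i : 'I_n, exists q : rat,
      `|ratr q - x ord0 i| < (k.+1%:R)^-1.
    move=> i.
    have := @rat_in_itvoo R (x ord0 i - (k.+1%:R)^-1) (x ord0 i + (k.+1%:R)^-1).
    case=> [|q]; first by rewrite ltrD2l gtrN// invr_gt0.
    by rewrite in_itv/= => /andP[q1 q2]; exists q; rewrite ltr_distl q1 q2.
  exists (\row_i q i, k) => //; rewrite /F.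
  case: asboolP => [_ i|]; first by rewrite mxE.
  case=> y Uy; apply: xeA; split => // i j; rewrite ord1.
  have := Uy j; rewrite /= mxE => qy; have := qx j.
  rewrite /ball/= => qx'; rewrite (_ : x _ _ - y _ _ =
    (ratr (q j) - y ord0 j) - (ratr (q j) - x ord0 j)); last by ring.
  rewrite (le_lt_trans (ler_normB _ _))// (splitr e).
  by rewrite ltrD// (lt_trans _ ke).
apply: countable_bigcupT_measurable; first exact: countableP.
by move=> qk; rewrite /F; case: asboolP.
Qed.

Lemma continuous_measurable_rV (R : realType) n (f : 'rV[R]_n -> R) :
  continuous f -> measurable_fun [set: 'rV[R]_n] f.
Proof.
move=> cf; apply: (measurability (@RGenOInfty.G R)).
  exact: RGenOInfty.measurableE.
move=> _ [_ [a ->] <-]; rewrite setTI; apply: open_measurable_rV.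
by apply: open_comp => [x _|]; [exact: cf|exact: interval_open].
Qed.

(** * Splitting off the first coordinate *)

Section lebesgue_rV_succ.
Context (R : realType) (n : nat).
Local Notation leb := (@lebesgue_measure R).
Local Notation m := (lebesgue_rV R n).

Lemma ge0_integral_rVS (F : 'rV[R]_n.+1 -> \bar R) :
  measurable_fun [set: 'rV[R]_n.+1] F -> (forall x, 0 <= F x)%E ->
  (\int[lebesgue_rV R n.+1]_x F x =
   \int[leb]_a \int[m]_v F (rV_cons (a, v)))%E.
Proof.
move=> mF F0; transitivity (\int[(leb \x m)%E]_z (F \o @rV_cons R n) z)%E.
  exact: (ge0_integral_pushforward (@measurable_rV_cons R n) (leb \x m)%E
    measurableT mF (fun x _ => F0 x)).
apply: fubini_tonelli1 => [|z]; last exact: F0.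
by apply: measurableT_comp => //; exact: measurable_rV_cons.
Qed.

Lemma integrable_rVS (F : 'rV[R]_n.+1 -> \bar R) :
  (lebesgue_rV R n.+1).-integrable [set: 'rV[R]_n.+1] F ->
  (leb \x m)%E.-integrable [set: _] (F \o @rV_cons R n).
Proof.
move=> /integrableP[mF iF]; apply/integrableP; split.
  by apply: measurableT_comp => //; exact: measurable_rV_cons.
move: iF; apply: le_lt_trans; rewrite le_eqVlt; apply/orP; left; apply/eqP/esym.
have maF : measurable_fun [set: 'rV[R]_n.+1] (abse \o F).
  exact: measurableT_comp.
exact: (ge0_integral_pushforward (@measurable_rV_cons R n) (leb \x m)%E
  measurableT maF (fun x _ => abse_ge0 _)).
Qed.

Lemma integral_rVS (F : 'rV[R]_n.+1 -> \bar R) :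
  (lebesgue_rV R n.+1).-integrable [set: 'rV[R]_n.+1] F ->
  (\int[lebesgue_rV R n.+1]_x F x =
   \int[(leb \x m)%E]_z F (rV_cons z))%E.
Proof.
move=> iF; have mF : measurable_fun [set: 'rV[R]_n.+1] F by exact: measurable_int iF.
exact: (integral_pushforward (@measurable_rV_cons R n) (mu := (leb \x m)%E)
  (D := setT) mF (integrable_rVS iF) measurableT).
Qed.

End lebesgue_rV_succ.

(** * Integrals of derivatives of compactly supported functions *)

Section bounded_box_support.
Context (R : realType).

(* Continuous functions with compact support, in a form which passes to the
   slices [fun v => f (rV_cons (a, v))]. *)
Definition Cc_fun n (f : 'rV[R]_n -> R) : Prop :=
  [/\ continuous f, exists M, forall x, `|f x| <= M
    & exists N, forall x : 'rV[R]_n, (exists i, N < `|x ord0 i|) -> f x = 0].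

Lemma lebesgue_rV_box_lty n (N : R) :
  (lebesgue_rV R n [set x | forall i, (`[(- N)%R, N]%classic) (x ord0 i)] < +oo)%E.
Proof.
rewrite (lebesgue_rV_box (A := fun=> `[(- N)%R, N]%classic))//.
under eq_bigr do rewrite lebesgue_measure_itv/=.
have -> : (if (- N)%:E < N%:E then N%:E - (- N)%:E else 0)%E =
    (if - N < N then N + N else 0)%:E.
  by rewrite lte_fin; case: ifP => // _; rewrite EFinN oppeK.
by rewrite prodEFin ltry.
Qed.

Lemma Cc_fun_integrable n (f : 'rV[R]_n -> R) : Cc_fun f ->
  (lebesgue_rV R n).-integrable [set: 'rV[R]_n] (EFin \o f).
Proof.
move=> [cf [M Mf] [N Nf]].
have mf := continuous_measurable_rV cf.
pose B := [set x : 'rV[R]_n | forall i, (`[(- N)%R, N]%classic) (x ord0 i)].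
have mB : measurable B.
  have -> : B = \bigcap_(i in [set: 'I_n])
      (fun x : 'rV[R]_n => x ord0 i) @^-1` `[(- N)%R, N]%classic.
    by apply/seteqP; split=> [y By i _|y By i]; exact: By.
  apply: fin_bigcap_measurable => [|i _]; first exact: finite_finset.
  have := @measurable_coord R n i measurableT _
    (measurable_itv `[(- N)%R, N] : measurable (`[(- N)%R, N]%classic : set R)).
  by rewrite setTI.
have -> : EFin \o f = (EFin \o f) \_ B.
  apply/funext => x; rewrite patchE; case: ifPn => //.
  rewrite notin_setE => Bx; rewrite /= Nf//.
  apply: contrapT => xN; apply: Bx => i; rewrite /= in_itv/= -ler_norml leNgt.
  by apply/negP => ?; apply: xN; exists i.
apply/(integrable_mkcond _ mB).
apply: measurable_bounded_integrable => //; first exact: lebesgue_rV_box_lty.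
  exact: measurable_funTS.
by exists M; split; [exact: num_real|move=> K /ltW MK x _; exact: le_trans MK].
Qed.

Lemma Cc_fun_lin n (a : R) (f g : 'rV[R]_n -> R) :
  Cc_fun f -> Cc_fun g -> Cc_fun (a *: f + g).
Proof.
move=> [cf [M Mf] [N Nf]] [cg [K Kg] [L Lg]]; split.
- by move=> x; apply: continuousD; [apply: continuousZl_tmp; exact: cf|exact: cg].
- exists (`|a| * M + K) => x; rewrite (le_trans (ler_normD _ _))// lerD//.
  by rewrite normrM ler_wpM2l.
- exists (Num.max N L) => x [i]; rewrite gt_max => /andP[Ni Li].
  rewrite (_ : (a *: f + g) x = a * f x + g x)// Nf ?Lg ?mulr0 ?addr0//.
    by exists i.
  by exists i.
Qed.

Lemma Cc_funM n (f g : 'rV[R]_n -> R) :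
  Cc_fun f -> Cc_fun g -> Cc_fun (f \* g).
Proof.
move=> [cf [M Mf] [N Nf]] [cg [K Kg] _]; split.
- by move=> x; apply: continuousM; [exact: cf|exact: cg].
- by exists (M * K) => x; rewrite normrM ler_pM.
- by exists N => x /Nf /= ->; rewrite mul0r.
Qed.

Lemma rV_cons0 n (a : R) (v : 'rV[R]_n) : rV_cons (a, v) ord0 ord0 = a.
Proof. by rewrite mxE unlift_none. Qed.

Lemma rV_cons_lift n (a : R) (v : 'rV[R]_n) i :
  rV_cons (a, v) ord0 (lift ord0 i) = v ord0 i.
Proof. by rewrite mxE liftK. Qed.

Lemma Cc_fun_slice n (f : 'rV[R]_n.+1 -> R) (a : R) :
  Cc_fun f -> Cc_fun (fun v => f (rV_cons (a, v))).
Proof.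
move=> [cf [M Mf] [N Nf]]; split; last 2 first.
- by exists M.
- by exists N => v [i Ni]; apply: Nf; exists (lift ord0 i); rewrite rV_cons_lift.
move=> v; apply: (@continuous_comp _ _ _ (fun v => rV_cons (a, v)) f); last exact: cf.
apply: continuous_rV => i; case: (unliftP ord0 i) => [j|] ->.
  under eq_fun do rewrite rV_cons_lift; exact: continuous_coord.
under eq_fun do rewrite rV_cons0; exact: cst_continuous.
Qed.

(** Both difference quotients are the same function of [h]. This identifies partial derivatives with
    derivatives of slices. *)
Lemma derive_along (V W : normedModType R) (f : V -> R) (g : W -> R) x u y w :
  (forall h : R, f (h *: u + x) = g (h *: w + y)) ->
  'D_u f x = 'D_w g y /\ (derivable f x u -> derivable g y w).
Proof.
move=> fg; rewrite /derive /derivable.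
have fgxy : f x = g y by have := fg 0; rewrite !scale0r !add0r.
suff -> : (fun h : R => h^-1 *: ((f \o shift x) (h *: u) - f x)) =
  (fun h : R => h^-1 *: ((g \o shift y) (h *: w) - g y)) by [].
by apply/funext => h; rewrite /= /shift fg fgxy.
Qed.

Lemma partial_slice_lift n (f : 'rV[R]_n.+1 -> R) (a : R) (j : 'I_n)
    (v : 'rV[R]_n) :
  partial (lift ord0 j) f (rV_cons (a, v)) =
    partial j (fun w => f (rV_cons (a, w))) v /\
  (derivable f (rV_cons (a, v)) (delta_mx ord0 (lift ord0 j)) ->
   derivable (fun w => f (rV_cons (a, w))) v (delta_mx ord0 j)).
Proof.
apply: derive_along => h; congr f; apply/rowP => i.
case: (unliftP ord0 i) => [k|] ->; rewrite !mxE ?liftK ?unlift_none/=.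
  by rewrite !mxE (inj_eq lift_inj).
by rewrite mulr0 add0r.
Qed.

Lemma partial_slice0 n (f : 'rV[R]_n.+1 -> R) (a : R) (v : 'rV[R]_n) :
  partial ord0 f (rV_cons (a, v)) = 'D_1 (fun b : R => f (rV_cons (b, v))) a /\
  (derivable f (rV_cons (a, v)) (delta_mx ord0 ord0) ->
   derivable (fun b : R => f (rV_cons (b, v))) a 1).
Proof.
apply: derive_along => h; congr f; apply/rowP => i.
case: (unliftP ord0 i) => [k|] ->; rewrite !mxE ?liftK ?unlift_none/=.
  by rewrite mulr0 add0r.
by [].
Qed.

Lemma integral_derive_Cc (G : R -> R) : (forall a, derivable G a 1) ->
  continuous ('D_1 G) ->
  (exists N, forall a, N < `|a| -> G a = 0 /\ 'D_1 G a = 0) ->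
  (\int[@lebesgue_measure R]_a ('D_1 G a)%:E = 0)%E.
Proof.
move=> dG cG' [N GN].
have cG : continuous G.
  by move=> a; apply: differentiable_continuous; apply/derivable1_diffP; exact: dG.
(* Positive and beyond [N] whatever the sign of [N], so [G] vanishes at both ends of the
   interval. *)
pose K := `|N| + 1.
have NK : N < K by rewrite /K (le_lt_trans (ler_norm _))// ltrDl.
have K0 : 0 < K by rewrite /K ltr_wpDl.
have -> : (\int[@lebesgue_measure R]_a ('D_1 G a)%:E =
    \int[@lebesgue_measure R]_(a in `[(- K)%R, K]) ('D_1 G a)%:E)%E.
  rewrite [RHS]integral_mkcond; apply: eq_integral => a _.
  rewrite patchE; case: ifPn => //; rewrite notin_setE/= in_itv/= -ler_norml.
  by move/negP; rewrite -ltNge => /(lt_trans NK)/GN[_ ->].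
rewrite (@continuous_FTC2 _ _ G); last 1 first.
- by move=> x _; rewrite derive1E.
- have [|-> _] := GN K; first by rewrite gtr0_norm.
  have [|-> _] := GN (- K); first by rewrite normrN gtr0_norm.
  by rewrite sube0.
- by rewrite gtrN.
- by apply: continuous_subspaceT => x; exact: cG'.
- split=> [x _||]; first exact: dG.
  + exact/cvg_at_right_filter/cG.
  + exact/cvg_at_left_filter/cG.
Qed.

(** Induction on the dimension with Fubini: for a later coordinate, freezing the first one leaves a
    slice to which the induction hypothesis applies; for the first coordinate, the inner integral is
    one-dimensional and the fundamental theorem of calculus gives 0. *)
Theorem Rintegral_partial n (i : 'I_n) (f : 'rV[R]_n -> R) :
  Cc_fun f -> (forall x, derivable f x (delta_mx ord0 i)) ->
  Cc_fun (partial i f) -> \int[lebesgue_rV R n]_x partial i f x = 0.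
Proof.
elim: n i f => [[]//|n IH] i f Cf df Cf'.
have if' := Cc_fun_integrable Cf'.
rewrite /Rintegral integral_rVS//.
have if'' := integrable_rVS if'.
move: Cf' df if'' {if'}; case: (unliftP ord0 i) => [j|] -> Cf' df if'.
  rewrite -integral12_prod_meas1//.
  rewrite integral0_eq// => a _ /=.
  have : \int[lebesgue_rV R n]_v partial j (fun w => f (rV_cons (a, w))) v = 0.
    apply: IH; first exact: Cc_fun_slice.
      by move=> v; apply: (partial_slice_lift f a j v).2.
    have := Cc_fun_slice a Cf'; congr Cc_fun; apply/funext => v.
    exact: (partial_slice_lift f a j v).1.
  rewrite /Rintegral /fubini_F/=.
  under eq_integral do rewrite -(partial_slice_lift f a j _).1.
  move=> int0; rewrite -[LHS]fineK ?int0//.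
  exact: integrable_fin_num (Cc_fun_integrable (Cc_fun_slice a Cf')).
(* Here the order of integration is reversed, with the first coordinate innermost. *)
rewrite -integral21_prod_meas1//.
rewrite integral0_eq// => v _ /=; rewrite /fubini_G/=.
under eq_integral do rewrite (partial_slice0 f _ v).1.
have cslice (g : 'rV[R]_n.+1 -> R) : continuous g ->
    continuous (fun b : R => g (rV_cons (b, v))).
  move=> cg b.
  apply: (@continuous_comp _ _ _ (fun b : R => rV_cons (b, v)) g); last exact: cg.
  apply: continuous_rV => k; case: (unliftP ord0 k) => [l|] ->.
    under eq_fun do rewrite rV_cons_lift; exact: cst_continuous.
  by under eq_fun do rewrite rV_cons0.
have [cf _ [N fN]] := Cf; have [cf' _ [K f'K]] := Cf'.
apply: integral_derive_Cc.
- by move=> a; apply: (partial_slice0 f a v).2.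
- under eq_fun do rewrite -(partial_slice0 f _ v).1.
  exact: cslice.
- exists (Num.max N K) => a; rewrite gt_max => /andP[Na Ka].
  by rewrite -(partial_slice0 f a v).1 fN ?f'K//; exists ord0; rewrite rV_cons0.
Qed.

End bounded_box_support.

(** * A positive integrable weight *)

Section gaussian_weight.
Context (R : realType).

(** The density of the standard normal law: positive, continuous, and a product over coordinates, so
    that Tonelli computes its integral by induction. *)
Definition gaussian_weight n (x : 'rV[R]_n) : R :=
  \prod_(i < n) normal_pdf 0 1 (x ord0 i).

Lemma gaussian_weight_gt0 n (x : 'rV[R]_n) : 0 < gaussian_weight x.
Proof.
apply: prodr_gt0 => i _; rewrite normal_pdfE ?oner_neq0//.
by rewrite mulr_gt0 ?expR_gt0// normal_peak_gt0// oner_neq0.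
Qed.

Lemma continuous_gaussian_weight n : continuous (@gaussian_weight n).
Proof.
rewrite /gaussian_weight; elim: (index_enum _) => [|i s IH].
  by under eq_fun do rewrite big_nil; exact: cst_continuous.
under eq_fun do rewrite big_cons; move=> x.
have cg : {for x, continuous (fun y : 'rV[R]_n => normal_pdf 0 1 (y ord0 i) : R)}.
  apply: (@continuous_comp _ _ _ (fun y : 'rV[R]_n => y ord0 i) (normal_pdf 0 1)).
    exact: continuous_coord.
  by apply: continuous_normal_pdf; exact: oner_neq0.
exact: (continuousM cg (IH x)).
Qed.

Lemma measurable_gaussian_weight n : measurable_fun [set: 'rV[R]_n]
  (fun x => (gaussian_weight x)%:E).
Proof.
apply/measurable_EFinP; apply: continuous_measurable_rV.
exact: continuous_gaussian_weight.
Qed.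

Lemma integral_gaussian_weight n :
  (\int[lebesgue_rV R n]_x (gaussian_weight x)%:E = 1)%E.
Proof.
elim: n => [|n IH].
  rewrite /= integral_dirac//.
    by rewrite diracE in_setT mul1e /gaussian_weight big_ord0.
  exact: measurable_gaussian_weight.
rewrite ge0_integral_rVS; last 2 first.
- exact: measurable_gaussian_weight.
- by move=> x; rewrite lee_fin ltW// gaussian_weight_gt0.
rewrite -(integral_normal_pdf 0 (1 : R)); apply: eq_integral => a _.
under eq_integral => v _.
  rewrite /gaussian_weight big_ord_recl rV_cons0.
  under eq_bigr do rewrite rV_cons_lift.
  rewrite EFinM; over.
rewrite ge0_integralZl ?IH ?mule1//.
- exact: measurable_gaussian_weight.
- by move=> x _; rewrite lee_fin ltW// gaussian_weight_gt0.
- by rewrite lee_fin normal_pdf_ge0.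
Qed.

Lemma integrable_gaussian_weight n :
  (lebesgue_rV R n).-integrable [set: 'rV[R]_n] (EFin \o @gaussian_weight n).
Proof.
apply/integrableP; split.
  exact: measurable_gaussian_weight.
under eq_integral do rewrite gee0_abs ?lee_fin ?(ltW (gaussian_weight_gt0 _))//.
by rewrite integral_gaussian_weight ltry.
Qed.

End gaussian_weight.

(** * Test functions and pairings *)

Section test_functions.
Context (R : realType) (d : nat).
Local Notation mu := (lebesgue_rV R d).
Implicit Types (phi psi : testfun R d).

Lemma Cc_fun_compact (K : set 'rV[R]_d) (f : 'rV[R]_d -> R) :
  compact K -> continuous f -> (forall x, ~ K x -> f x = 0) -> Cc_fun f.
Proof.
move=> cK cf f0; split => //.
- have /compact_bounded [M [_ Mf]] : compact [set f x | x in K].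
    by apply: continuous_compact => //; exact: continuous_subspaceT.
  exists (`|M| + 1) => x; have [Kx|/f0 ->] := pselect (K x); last first.
    by rewrite normr0 addr_ge0.
  by apply: Mf; [rewrite (le_lt_trans (ler_norm _))// ltrDl|exists x].
- have [N [_ NK]] := compact_bounded cK.
  exists (`|N| + 1) => x [i Ni]; apply: f0 => Kx; move: Ni; apply/negP.
  rewrite -leNgt.
  have xN : `|x| <= `|N| + 1.
    by apply: NK => //; rewrite (le_lt_trans (ler_norm _))// ltrDl.
  apply: le_trans xN; rewrite [leRHS]/Num.norm/= mx_normrE.
  exact: (le_bigmax _ (fun ij : 'I_1 * 'I_d => `|x ij.1 ij.2|) (ord0, i)).
Qed.

Lemma testfun_smooth phi : smooth phi.
Proof. by have /test_predP[] := testfunP phi. Qed.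

Lemma testfun_compact phi : compact (support_closure phi).
Proof. by have /test_predP[] := testfunP phi. Qed.

(** The complement of the support is open, so the function to be differentiated vanishes near [x] by
    induction. *)
Lemma partials_out phi s x : ~ support_closure phi x -> partials s phi x = 0.
Proof.
elim: s x => [|i s IH] x /= Kx.
  by apply/eqP; apply: contrapT => /negP phix; apply: Kx; exact: subset_closure.
rewrite /partial -/(partials s phi).
have nK : \forall y \near x, partials s phi y = (cst 0 : 'rV[R]_d -> R) y.
  have : nbhs x (~` support_closure phi).
    by apply: open_nbhs_nbhs; split => //; rewrite openC; exact: closed_closure.
  by apply: filterS => y /IH.
by rewrite (near_eq_derive _ nK) derive_cst.
Qed.

Lemma Cc_fun_partials phi s : Cc_fun (partials s phi).
Proof.
apply: (Cc_fun_compact (@testfun_compact phi)); first exact: (testfun_smooth phi s).1.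
exact: partials_out.
Qed.

Lemma Cc_fun_testfun phi : Cc_fun phi.
Proof. exact: (Cc_fun_partials phi [::]). Qed.

Lemma Cc_fun_partial phi i : Cc_fun (partial i phi).
Proof. exact: (Cc_fun_partials phi [:: i]). Qed.

Lemma derivable_testfun phi i x : derivable phi x (delta_mx ord0 i).
Proof. exact: ((testfun_smooth phi [::]).2 i x). Qed.

(** The product [phi psi] is compactly supported, hence its partial derivative has integral 0. *)
Lemma Rintegral_by_parts phi psi i :
  \int[mu]_x (phi x * partial i psi x) = - \int[mu]_x (partial i phi x * psi x).
Proof.
have pE : partial i (phi \* psi) =
    fun x => phi x * partial i psi x + partial i phi x * psi x.
  apply/funext => x; rewrite /partial deriveM; try exact: derivable_testfun.
  by congr (_ + _); exact: mulrC.
have c1 := Cc_funM (Cc_fun_testfun phi) (Cc_fun_partial psi i).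
have c2 := Cc_funM (Cc_fun_partial phi i) (Cc_fun_testfun psi).
have := @Rintegral_partial R d i (phi \* psi)
  (Cc_funM (Cc_fun_testfun phi) (Cc_fun_testfun psi)).
rewrite pE RintegralD//; try exact: Cc_fun_integrable.
move=> H; apply/eqP; rewrite -addr_eq0; apply/eqP/H.
  by move=> x; apply: derivableM; exact: derivable_testfun.
by have := Cc_fun_lin 1 c1 c2; rewrite scale1r.
Qed.

Definition grad phi (x : 'rV[R]_d) : 'rV[R]_d := \row_i partial i phi x.

Lemma measurable_grad phi i :
  measurable_fun [set: 'rV[R]_d] (fun x => grad phi x ord0 i).
Proof.
under eq_fun do rewrite mxE; apply: continuous_measurable_rV.
by have [] := Cc_fun_partial phi i.
Qed.

Lemma measurable_norm_grad phi :
  measurable_fun [set: 'rV[R]_d] (fun x => euclid_norm (grad phi x)).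
Proof. by apply: measurable_euclid_norm; exact: measurable_grad. Qed.

Lemma integrable_norm_grad phi :
  mu.-integrable [set: 'rV[R]_d] (EFin \o (fun x => euclid_norm (grad phi x))).
Proof.
apply: (@le_integrable _ _ _ mu _ measurableT _
    (fun x => (\sum_(i < d) `|partial i phi x|)%:E)).
- by apply/measurable_EFinP; exact: measurable_norm_grad.
- move=> x _; rewrite /= lee_fin ger0_norm ?euclid_norm_ge0//.
  rewrite [leRHS]ger0_norm ?sumr_ge0//.
  have -> : grad phi x = \sum_(i < d) partial i phi x *: delta_mx ord0 i.
    by rewrite [LHS]row_sum_delta; apply: eq_bigr => i _; rewrite mxE.
  elim/big_rec2 : _ => [|i b y _ IH]; first by rewrite euclid_norm0.
  rewrite (le_trans (euclid_normD _ _))// lerD//.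
  by rewrite euclid_normZ euclid_norm_delta mulr1.
- under eq_fun do rewrite -sumEFin.
  apply: integrable_sum => // i _; apply: integrable_norm.
  exact: Cc_fun_integrable (Cc_fun_partial phi i).
Qed.

Lemma measurable_field_dot (u v : 'rV[R]_d -> 'rV[R]_d) :
  (forall i, measurable_fun [set: 'rV[R]_d] (fun x => u x ord0 i)) ->
  (forall i, measurable_fun [set: 'rV[R]_d] (fun x => v x ord0 i)) ->
  measurable_fun [set: 'rV[R]_d] (fun x => \sum_(i < d) u x ord0 i * v x ord0 i).
Proof. by move=> mu_ mv; apply: measurable_sum => i; exact: measurable_funM. Qed.

Section pairing.
Variables (u : 'rV[R]_d -> 'rV[R]_d) (C : R).
Hypothesis u_meas : forall i, measurable_fun [set: 'rV[R]_d] (fun x => u x ord0 i).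
Hypothesis u_le : {ae mu, forall x, euclid_norm (u x) <= C}.
Hypothesis C_ge0 : 0 <= C.

Let dot_le phi : (\int[mu]_x `|\sum_(i < d) u x ord0 i * grad phi x ord0 i|%:E <=
  \int[mu]_x (C * euclid_norm (grad phi x))%:E)%E.
Proof.
apply: ae_ge0_le_integral => //.
- apply/measurable_EFinP/measurableT_comp => //.
  by apply: measurable_field_dot => //; exact: measurable_grad.
- by move=> x _; rewrite lee_fin mulr_ge0// euclid_norm_ge0.
- by apply/measurable_EFinP/measurable_funM => //; exact: measurable_norm_grad.
apply: filterS u_le => x uC _; rewrite lee_fin.
(* Cauchy-Schwarz for both [u] and [- u] bounds the absolute value. *)
have := dot_le_euclid_norm (u x) (grad phi x).
have := dot_le_euclid_norm (- u x) (grad phi x).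
have -> : \sum_(i < d) (- u x) ord0 i * grad phi x ord0 i =
    - \sum_(i < d) u x ord0 i * grad phi x ord0 i.
  by rewrite -sumrN; apply: eq_bigr => i _; rewrite mxE mulNr.
rewrite euclid_normN => h1 h2.
apply: (@le_trans _ _ (euclid_norm (u x) * euclid_norm (grad phi x))).
  by rewrite ler_norml h2 lerNl h1.
by rewrite ler_wpM2r// euclid_norm_ge0.
Qed.

Let iCgrad phi : mu.-integrable [set: 'rV[R]_d]
  (EFin \o (fun x => C * euclid_norm (grad phi x))).
Proof. exact: (integrableZl measurableT C (integrable_norm_grad phi)). Qed.

Lemma integrable_field_dot phi : mu.-integrable [set: 'rV[R]_d]
  (EFin \o (fun x => \sum_(i < d) u x ord0 i * grad phi x ord0 i)).
Proof.
apply/integrableP; split.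
  apply/measurable_EFinP; apply: measurable_field_dot => // i.
  exact: measurable_grad.
apply: le_lt_trans (dot_le phi) _.
have := integrable_fin_num measurableT (iCgrad phi).
by rewrite fin_numElt => /andP[].
Qed.

Lemma Rintegral_field_dot_le phi :
  \int[mu]_x `|\sum_(i < d) u x ord0 i * grad phi x ord0 i| <=
  C * \int[mu]_x euclid_norm (grad phi x).
Proof.
rewrite -RintegralZl//; last exact: integrable_norm_grad.
rewrite fine_le//.
- apply: integrable_fin_num => //; apply: integrable_norm.
  exact: integrable_field_dot.
- exact: integrable_fin_num (iCgrad phi).
Qed.

End pairing.
End test_functions.

(** * Bounded fields and total variation *)

Section Linfty.
Context (R : realType) (d : nat).
Local Notation mu := (lebesgue_rV R d).
Implicit Types (u v : 'rV[R]_d -> 'rV[R]_d) (phi : testfun R d).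

Lemma Linfty_norm_leP u (C : R) :
  (Linfty_norm u <= C%:E)%E <-> {ae mu, forall x, euclid_norm (u x) <= C}.
Proof.
by split=> [/ess_supP|uC]; [|apply/ess_supP; move: uC]; apply: filterS => x;
  rewrite lee_fin.
Qed.

(** An essential supremum of nonnegative values is nonnegative once the measure is nonzero, which
    the Gaussian of integral 1 shows. *)
Lemma Linfty_norm_ge0 u : (0 <= Linfty_norm u)%E.
Proof.
apply: ess_sup_ger => [|x]; last by rewrite lee_fin euclid_norm_ge0.
rewrite lt_neqAle measure_ge0 andbT eq_sym; apply/eqP => mu0.
have := integral_gaussian_weight R d; rewrite null_set_integral//.
  by move=> /eqP; rewrite eq_sym onee_eq0.
exact: measurable_gaussian_weight.
Qed.

Lemma in_Linfty_coord u : in_Linfty u ->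
  forall i, measurable_fun [set: 'rV[R]_d] (fun x => u x ord0 i).
Proof.
by move=> [mu_ _] i; apply: (measurableT_comp (@measurable_coord R d i)).
Qed.

Lemma in_Linfty_fin u : in_Linfty u ->
  exists2 C, 0 <= C & Linfty_norm u = C%:E.
Proof.
move=> [_ uoo]; have u0 := Linfty_norm_ge0 u.
exists (fine (Linfty_norm u)); first exact: fine_ge0.
by rewrite fineK// ge0_fin_numE.
Qed.

Lemma in_Linfty_ae u C : Linfty_norm u = C%:E ->
  {ae mu, forall x, euclid_norm (u x) <= C}.
Proof. by move=> uC; apply/Linfty_norm_leP; rewrite uC. Qed.

Lemma in_Linfty_integrable u phi : in_Linfty u -> mu.-integrable [set: 'rV[R]_d]
  (EFin \o (fun x => \sum_(i < d) u x ord0 i * grad phi x ord0 i)).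
Proof.
move=> iu; have [C C0 uC] := in_Linfty_fin iu.
apply: (integrable_field_dot (C := C)) => //; first exact: in_Linfty_coord.
exact: in_Linfty_ae.
Qed.

Lemma distr_divE u phi :
  distr_div u phi = - \int[mu]_x (\sum_(i < d) u x ord0 i * grad phi x ord0 i).
Proof.
by congr (- _); apply: eq_Rintegral => x _; apply: eq_bigr => i _; rewrite mxE.
Qed.

(** Continuity of the divergence from L^infinity to distributions, by which the equation passes to
    the limit of the series. *)
Lemma distr_div_le u phi C : in_Linfty u -> 0 <= C -> (Linfty_norm u <= C%:E)%E ->
  `|distr_div u phi| <= C * \int[mu]_x euclid_norm (grad phi x).
Proof.
move=> iu C0 /Linfty_norm_leP uC; have mu_ := in_Linfty_coord iu.
rewrite distr_divE normrN (le_trans _ (Rintegral_field_dot_le mu_ uC C0 phi))//.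
by apply: le_normr_Rintegral => //; exact: in_Linfty_integrable.
Qed.

Lemma in_Linfty_lin (a : R) u v : in_Linfty u -> in_Linfty v ->
  in_Linfty (fun x => a *: u x + v x) /\
  (Linfty_norm (fun x => (a *: u x + v x)%R) <=
   `|a|%:E * Linfty_norm u + Linfty_norm v)%E.
Proof.
move=> iu iv; have [C C0 uC] := in_Linfty_fin iu; have [K K0 vK] := in_Linfty_fin iv.
have le : (Linfty_norm (fun x => (a *: u x + v x)%R) <= (`|a| * C + K)%:E)%E.
  apply/Linfty_norm_leP; near=> x.
  rewrite (le_trans (euclid_normD _ _))// lerD//.
    rewrite euclid_normZ ler_wpM2l//; near: x; exact: in_Linfty_ae.
  by near: x; exact: in_Linfty_ae.
split; last by rewrite uC vK.
split; last by rewrite (le_lt_trans le)// ltry.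
apply: measurable_fun_rV => i; under eq_fun do rewrite !mxE.
by apply: measurable_funD; [apply: measurable_funM|]; last 2 first;
  [exact: in_Linfty_coord..|].
Unshelve. all: by end_near. Qed.

Lemma distr_div_lin (a : R) u v : in_Linfty u -> in_Linfty v ->
  distr_div (fun x => a *: u x + v x) = a *: distr_div u + distr_div v.
Proof.
move=> iu iv; apply/funext => phi.
rewrite [RHS](_ : _ = a * distr_div u phi + distr_div v phi)// !distr_divE.
rewrite mulrN -opprD; congr (- _); rewrite -RintegralZl//; last first.
  exact: in_Linfty_integrable.
rewrite -RintegralD//; last exact: in_Linfty_integrable.
  apply: eq_Rintegral => x _; rewrite mulr_sumr -big_split/=.
  by apply: eq_bigr => i _; rewrite !mxE mulrDl mulrA.
exact: (integrableZl measurableT a (in_Linfty_integrable phi iu)).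
Qed.

End Linfty.

(** * Total variation of test functions *)

Section total_variation.
Context (R : realType) (d : nat).
Local Notation mu := (lebesgue_rV R d).
Implicit Types (phi : testfun R d).

(** Integration by parts moves the divergence of [w] onto [phi]; Cauchy-Schwarz with [|w| <= 1]
    almost everywhere then bounds the integral. *)
Lemma TV_testfun_le phi : (TV phi <= (\int[mu]_x euclid_norm (grad phi x))%:E)%E.
Proof.
apply: ge_ereal_sup => _ [w /= /Linfty_norm_leP w1 <-]; rewrite lee_fin.
have iw i : mu.-integrable [set: 'rV[R]_d]
    (EFin \o (fun x => phi x * partial i (w i) x)).
  by apply: Cc_fun_integrable; apply: Cc_funM;
    [exact: Cc_fun_testfun|exact: Cc_fun_partial].
have iw' i : mu.-integrable [set: 'rV[R]_d]
    (EFin \o (fun x => partial i phi x * w i x)).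
  by apply: Cc_fun_integrable; apply: Cc_funM;
    [exact: Cc_fun_partial|exact: Cc_fun_testfun].
have mw i : measurable_fun [set: 'rV[R]_d] (fun x => test_field w x ord0 i).
  under eq_fun do rewrite mxE; apply: continuous_measurable_rV.
  by have [] := Cc_fun_testfun (w i).
have -> : \int[mu]_x (phi x * test_div w x) =
    - \int[mu]_x (\sum_(i < d) test_field w x ord0 i * grad phi x ord0 i).
  under eq_Rintegral do rewrite mulr_sumr.
  rewrite Rintegral_sum//; under eq_bigr do rewrite Rintegral_by_parts.
  rewrite sumrN -Rintegral_sum//; congr (- _); apply: eq_Rintegral => x _.
  by apply: eq_bigr => i _; rewrite !mxE mulrC.
rewrite (le_trans (ler_norm _))// normrN.
have := Rintegral_field_dot_le mw w1 ler01 phi; rewrite mul1r; apply: le_trans.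
apply: le_normr_Rintegral => //.
exact: (integrable_field_dot mw w1 ler01).
Qed.

Lemma TV_ge0 (v : 'rV[R]_d -> R) : (0 <= TV v)%E.
Proof.
apply: ereal_sup_ubound; exists (fun=> 0) => /=.
  apply/Linfty_norm_leP; apply: aeW => x.
  rewrite (_ : test_field _ x = 0) ?euclid_norm0//.
  by apply/rowP => i; rewrite !mxE.
congr EFin; rewrite -[RHS](_ : \int[mu]_x (cst 0 x) = 0); last first.
  by rewrite Rintegral_cst// mul0r.
apply: eq_Rintegral => x _; rewrite /test_div big1 ?mulr0// => i _.
by rewrite /partial derive_cst.
Qed.

Lemma in_BV_testfun phi : in_BV phi.
Proof.
split; first exact: Cc_fun_integrable (Cc_fun_testfun phi).
by rewrite (le_lt_trans (TV_testfun_le phi))// ltry.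
Qed.

End total_variation.

Lemma dual_norm_bound (R : realType) (V : normedModType R) (L : V -> R)
    (c : R) (y : V) :
  scalar L -> (dual_norm L <= c%:E)%E -> `|L y| <= c * `|y|.
Proof.
move=> Llin Lc.
have LZ a v : L (a *: v) = a * L v.
  have L0 : L 0 = 0.
    by have := Llin 1 0 0; rewrite scale1r addr0 mul1r; lra.
  by have := Llin a v 0; rewrite !addr0 L0 addr0.
have [->|y0] := eqVneq y 0.
  by have := LZ 0 0; rewrite scale0r mul0r => ->; rewrite !normr0 mulr0.
have ny : 0 < `|y| by rewrite normr_gt0.
have : (`|L (`|y|^-1 *: y)|%:E <= c%:E)%E.
  apply: le_trans Lc; apply: ereal_sup_ubound; exists (`|y|^-1 *: y) => //=.
  by rewrite normrZ normfV normr_id mulVf// gt_eqF.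
by rewrite lee_fin LZ normrM normfV normr_id mulrC ler_pdivrMr.
Qed.

(** * Bounded solutions of the divergence equation *)

Section dual_space.
Context (R : realType) (d : nat) (Y : dual_distribution_space R d).
Local Notation mu := (lebesgue_rV R d).
Implicit Types (y f : Y) (phi : testfun R d).

(** The number [t] is the total variation of [phi]. It is kept apart from its upper bound because
    replacing it by the integral requires [0 <= beta], which [BV_embedded_gt0] derives from this
    very estimate. *)
Lemma BV_embedded_testfun_bound beta : BV_embedded_in_dual Y beta ->
  forall y phi, exists t, [/\ 0 <= t, t <= \int[mu]_x euclid_norm (grad phi x)
    & `|to_distribution y phi| <= beta * t * `|y|].
Proof.
move=> [J [Jdual _ Jtest _ Jle]] y phi.
have TV0 := TV_ge0 phi; have TVle := TV_testfun_le phi.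
have TVfin : TV phi \is a fin_num by rewrite ge0_fin_numE// (le_lt_trans TVle)// ltry.
exists (fine (TV phi)); split; first exact: fine_ge0.
  by rewrite -lee_fin fineK.
rewrite -Jtest; apply: dual_norm_bound; first exact: (Jdual _ (in_BV_testfun phi)).1.
by rewrite EFinM fineK// Jle//; exact: in_BV_testfun.
Qed.

Lemma to_distribution_neq0 f : f != 0 -> exists phi, to_distribution f phi != 0.
Proof.
move=> f0; apply: contrapT => nf.
have fphi phi : to_distribution f phi = 0.
  by apply/eqP; apply: contrapT => /negP ?; apply: nf; exists phi.
have : (`|f|%:E <= 0)%E.
  rewrite dds_norm; apply: ge_ereal_sup => _ [phi _ <-].
  by have := fphi phi; rewrite /to_distribution => ->.
by rewrite lee_fin normr_le0 (negbTE f0).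
Qed.

(** Some test function pairs nontrivially with [f], and the estimate for that pairing would fail if
    [beta <= 0]. *)
Lemma BV_embedded_gt0 beta f : BV_embedded_in_dual Y beta -> f != 0 -> 0 < beta.
Proof.
move=> hBV f0; have [phi fphi] := to_distribution_neq0 f0.
have [t [t0 _ fle]] := BV_embedded_testfun_bound hBV f phi.
rewrite ltNge; apply/negP => b0; move: fphi; rewrite -normr_gt0.
move=> /lt_le_trans/(_ fle).
by rewrite ltNge => /negP; apply; rewrite mulr_le0_ge0// mulr_le0_ge0.
Qed.

Theorem div_surjective beta : BV_embedded_in_dual Y beta -> 0 <= beta ->
  forall y, exists h, [/\ in_Linfty h, (Linfty_norm h <= (beta * `|y|)%:E)%E
    & distr_div h = to_distribution y].
Proof.
move=> hBV b0 y; pose C := beta * `|y|.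
have C0 : 0 <= C by rewrite mulr_ge0.
pose rho := @gaussian_weight R d.
have rho_gt0 x : 0 < rho x by exact: gaussian_weight_gt0.
(* The factor [rho^-1] cancels the weight in the norm and in the final integral. *)
pose psi phi x := (rho x)^-1 *: grad phi x.
(* The minus sign is that of the distributional divergence. *)
pose G := [set z | exists phi, z = (psi phi, - to_distribution y phi)].
have psi_lin a phi phi' : psi (a *: phi + phi') = a *: psi phi + psi phi'.
  apply/funext => x.
  rewrite [RHS](_ : _ = a *: psi phi x + psi phi' x)// /psi.
  rewrite scalerA mulrC -scalerA -scalerDr; congr (_ *: _).
  apply/rowP => i; rewrite !mxE.
  have := partials_lin a [:: i] (testfun_smooth phi) (testfun_smooth phi').
  by move=> /(congr1 (fun g => g x)).
have y_lin a phi phi' : to_distribution y (a *: phi + phi') =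
    a * to_distribution y phi + to_distribution y phi'.
  by rewrite /to_distribution linearP; exact: (dds_pair_dual y).1.
have y0 : to_distribution y 0 = 0.
  by have := y_lin (-1) 0 0; rewrite scaleN1r addNr mulN1r addNr.
have rho_psi phi x : rho x * euclid_norm (psi phi x) = euclid_norm (grad phi x).
  rewrite euclid_normZ ger0_norm ?invr_ge0 ?(ltW (rho_gt0 x))// mulrA.
  by rewrite mulfV ?mul1r// gt_eqF.
(* The function [rho^-1] is unbounded on R^d in positive dimension, but it is continuous and the
   partial derivatives of [phi] vanish off a compact set. *)
have bounded_psi phi : bounded_field (psi phi).
  move=> i; under eq_fun do rewrite mxE mxE.
  have crho : continuous (fun x => (rho x)^-1).
    move=> x; apply: continuousV; first by rewrite gt_eqF.
    exact: continuous_gaussian_weight.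
  have [cphi _ _] := Cc_fun_partial phi i.
  have cprod : continuous (fun x => (rho x)^-1 * partial i phi x).
    by move=> x; exact: (continuousM (crho x) (cphi x)).
  have [|_ bprod _] := Cc_fun_compact (@testfun_compact _ _ phi) cprod.
    move=> x Kx; rewrite (_ : partial i phi x = 0) ?mulr0//.
    exact: (partials_out [:: i] Kx).
  by split => //; exact: continuous_measurable_rV.
have [|||h [mh hC Gh]] := @field_functional_representation _ _ R d mu rho C C0
  rho_gt0 (integrable_gaussian_weight R d) G.
- exists 0; rewrite y0 oppr0; congr pair.
  have := psi_lin (-1) 0 0; rewrite !scaleN1r !addNr; exact: esym.
- move=> a _ _ _ _ [phi [-> ->]] [phi' [-> ->]]; exists (a *: phi + phi').
  by rewrite psi_lin y_lin opprD mulrN.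
- move=> _ _ [phi [-> ->]]; split; first exact: bounded_psi.
  under eq_Rintegral do rewrite rho_psi.
  have [t [t0 tle ft]] := BV_embedded_testfun_bound hBV y phi.
  rewrite (le_trans (ler_norm _))// normrN (le_trans ft)// mulrAC.
  by rewrite ler_wpM2l.
have ih : in_Linfty h.
  split; first exact: measurable_fun_rV.
  by rewrite (le_lt_trans ((Linfty_norm_leP h C).2 hC))// ltry.
exists h; split => //; first exact/Linfty_norm_leP.
apply/funext => phi; rewrite distr_divE.
have /Gh : G (psi phi, - to_distribution y phi) by exists phi.
move=> /(congr1 -%R); rewrite opprK => ->; congr (- _).
apply: eq_Rintegral => x _; rewrite mulr_sumr; apply: eq_bigr => i _.
by rewrite [psi phi x _ _]mxE mulrCA (mulrA (rho x)) mulfV ?mul1r// gt_eqF.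
Qed.

End dual_space.

(** * Geometric series in L^infinity *)

Section Linfty_complete.
Context (R : realType) (d : nat).
Local Notation mu := (lebesgue_rV R d).

Lemma cvg_euclid_norm (s : nat -> 'rV[R]_d) (y : 'rV[R]_d) :
  (forall i, s n ord0 i @[n --> \oo] --> y ord0 i) ->
  euclid_norm (s n) @[n --> \oo] --> euclid_norm y.
Proof.
move=> sy; rewrite /euclid_norm.
apply: (@continuous_cvg _ _ _ _ _ _ (@Num.sqrt R)); first exact: sqrt_continuous.
elim: (index_enum _) => [|i l IH].
  by under eq_fun do rewrite big_nil; rewrite big_nil; exact: cvg_cst.
under eq_fun do rewrite big_cons; rewrite big_cons.
apply: cvgD; last exact: IH.
under eq_fun do rewrite expr2; rewrite expr2.
by apply: cvgM; exact: sy.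
Qed.

(** After changes on null sets the series is dominated by a geometric one at every point, so it
    converges pointwise to a measurable field. The constant is the tail: the [c / 2 ^+ j] with
    [j >= n] add up to [2 * c / 2 ^+ n]. *)
Lemma Linfty_series (a : nat -> 'rV[R]_d -> 'rV[R]_d) (c : R) :
  (forall j, in_Linfty (a j)) ->
  (forall j, (Linfty_norm (a j) <= (c / 2 ^+ j)%:E)%E) ->
  exists U : 'rV[R]_d -> 'rV[R]_d, in_Linfty U /\
    forall n, (Linfty_norm (fun x => (\sum_(0 <= j < n) a j x - U x)%R) <=
      (2 * c / 2 ^+ n)%:E)%E.
Proof.
move=> ia ac.
have c0 : 0 <= c.
  have := le_trans (Linfty_norm_ge0 _) (ac 0); rewrite lee_fin expr0 divr1; exact.
(* Setting the field to 0 where its bound fails makes the bound valid everywhere; the union over [j]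
   of these exceptional sets is still null. *)
pose b j x := if euclid_norm (a j x) <= c / 2 ^+ j then a j x else 0.
have b_le j x : euclid_norm (b j x) <= c / 2 ^+ j.
  by rewrite /b; case: ifPn => // _; rewrite euclid_norm0 divr_ge0// exprn_ge0.
have mb j i : measurable_fun [set: 'rV[R]_d] (fun x => b j x ord0 i).
  have -> : (fun x => b j x ord0 i) = fun x =>
      if euclid_norm (a j x) <= c / 2 ^+ j then a j x ord0 i else 0.
    by apply/funext => x; rewrite /b; case: ifP => //; rewrite mxE.
  apply: measurable_fun_ifT => //; last exact: in_Linfty_coord.
  apply: measurable_fun_ler => //.
  by apply: measurable_euclid_norm; exact: in_Linfty_coord.
have ab : {ae mu, forall x, forall j, a j x = b j x}.
  have : {ae mu, forall x, forall j, euclid_norm (a j x) <= c / 2 ^+ j}.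
    by apply/ae_foralln => j; exact/Linfty_norm_leP.
  by apply: filterS => x ax j; rewrite /b ax.
(* The right-hand side is the exact sum of [c / 2 ^+ j] for [n <= j < n + m], a form suited to
   induction on [m]. *)
have tail n m x : euclid_norm (\sum_(0 <= j < n) b j x - \sum_(0 <= j < n + m) b j x)
    <= 2 * c / 2 ^+ n - 2 * c / 2 ^+ (n + m).
  elim: m => [|m IH]; first by rewrite addn0 !subrr euclid_norm0.
  rewrite addnS big_nat_recr//= opprD addrA (le_trans (euclid_normD _ _))//.
  rewrite euclid_normN; have := b_le (n + m)%N x.
  rewrite exprS invfM mulrA (_ : 2 * c / 2 = c); last by field.
  have E : 2 * c / 2 ^+ (n + m) = c / 2 ^+ (n + m) + c / 2 ^+ (n + m) by ring.
  by move: IH; rewrite E; lra.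
have cvg_b x i : cvgn (fun n => \sum_(0 <= j < n) b j x ord0 i).
  apply: (@normed_cvg _ _ (fun j => b j x ord0 i)).
  apply: (@series_le_cvg _ _ (geometric c 2^-1)) => [n|n|n|] //=.
  - by rewrite mulr_ge0// exprn_ge0// invr_ge0.
  - by rewrite exprVn (le_trans (le_euclid_norm _ _)).
  - by apply: is_cvg_geometric_series; rewrite ger0_norm ?invr_ge0// invf_lt1// ltr1n.
pose U x : 'rV[R]_d := \row_i limn (fun n => \sum_(0 <= j < n) b j x ord0 i).
have cvgU x i : (\sum_(0 <= j < n) b j x) ord0 i @[n --> \oo] --> U x ord0 i.
  by under eq_fun do rewrite summxE; rewrite mxE; exact: cvg_b.
have U_le n x : euclid_norm (\sum_(0 <= j < n) b j x - U x) <= 2 * c / 2 ^+ n.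
  have : euclid_norm (\sum_(0 <= j < n) b j x - \sum_(0 <= j < m) b j x) @[m --> \oo] -->
      euclid_norm (\sum_(0 <= j < n) b j x - U x).
    apply: cvg_euclid_norm => i; rewrite mxE [X in _ --> _ + X]mxE.
    under eq_fun do rewrite mxE [X in _ + X]mxE.
    by apply: cvgB; [exact: cvg_cst|exact: cvgU].
  move=> /cvgr_to_le; apply; near=> m.
  have nm : (n <= m)%N by near: m; exists n.
  rewrite -(subnKC nm) (le_trans (tail _ _ _))// gerBl divr_ge0//.
  by rewrite mulr_ge0.
have mU : measurable_fun [set: 'rV[R]_d] U.
  apply: measurable_fun_rV => i.
  apply/measurable_EFinP.
  apply: (emeasurable_fun_cvg (fun n x => (\sum_(0 <= j < n) b j x ord0 i)%:E)).
    by move=> n; apply/measurable_EFinP; exact: measurable_sum.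
  move=> x _; apply: cvg_EFin; first exact: nearW.
  by have := cvgU x i; under eq_fun do rewrite summxE.
have U_norm n : (Linfty_norm (fun x => (\sum_(0 <= j < n) a j x - U x)%R) <=
    (2 * c / 2 ^+ n)%:E)%E.
  apply/Linfty_norm_leP; apply: filterS ab => x abx.
  by under eq_bigr do rewrite abx.
exists U; split => //; split => //.
rewrite (@le_lt_trans _ _ (2 * c)%:E) ?ltry//.
have := U_norm 0; rewrite expr0 divr1 => /Linfty_norm_leP U0.
apply/Linfty_norm_leP; apply: filterS U0 => x.
by rewrite big_geq// sub0r euclid_normN.
Unshelve. all: by end_near. Qed.

End Linfty_complete.

(** * Minimizers *)

Section minimizers.
Context (R : realType) (d : nat) (Y : dual_distribution_space R d).
Implicit Types (y : Y) (phi : testfun R d).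

Lemma to_distribution_lin (a : R) y y' :
  to_distribution (a *: y + y') = a *: to_distribution y + to_distribution y'.
Proof. by apply/funext => phi; exact: dds_pair_linear. Qed.

Lemma to_distribution_inj : injective (@to_distribution R d Y).
Proof.
move=> y y' yy'; apply/eqP; rewrite -subr_eq0; apply: contrapT => /negP.
move=> /to_distribution_neq0[phi]; apply/negP; rewrite negbK.
rewrite addrC -scaleN1r to_distribution_lin yy' scaleN1r addNr.
exact/eqP.
Qed.

Lemma Ynorm_to_distribution y : Ynorm Y (to_distribution y) = `|y|%:E.
Proof.
rewrite /Ynorm (_ : [set _ | _ in _] = [set `|y|%:E]) ?ereal_inf1//.
apply/seteqP; split=> [_ [y' /= /to_distribution_inj -> <-]//|_ ->].
by exists y.
Qed.

Lemma Ynorm_lty T : (Ynorm Y T < +oo)%E -> exists y, T = to_distribution y.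
Proof.
rewrite /Ynorm; set A := [set _ | _ in _] => Aoo.
have [A0|/set0P[_ [y /= <- _]]] := eqVneq A set0; last by exists y.
by move: Aoo; rewrite A0 ereal_inf0 ltxx.
Qed.

Lemma in_Linfty0 : in_Linfty (0 : 'rV[R]_d -> 'rV[R]_d) /\
  (Linfty_norm (0%R : 'rV[R]_d -> 'rV[R]_d) <= 0)%E.
Proof.
have le : (Linfty_norm (0%R : 'rV[R]_d -> 'rV[R]_d) <= 0%:E)%E.
  by apply/Linfty_norm_leP; apply: aeW => x; rewrite euclid_norm0.
split=> //; split; last by rewrite (le_lt_trans le)// ltry.
apply: measurable_fun_rV => i; have := @measurable_cst _ _ 'rV[R]_d R setT 0.
by congr measurable_fun; apply/funext => x; rewrite mxE.
Qed.

Lemma distr_div0 : distr_div (0 : 'rV[R]_d -> 'rV[R]_d) = 0.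
Proof.
have := distr_div_lin (-1) in_Linfty0.1 in_Linfty0.1.
rewrite scaleN1r addNr => <-; congr distr_div; apply/funext => x.
by rewrite scaler0 addr0.
Qed.

(* Competitors [u + e h], where [div h] is the residual: letting [e] go to [0]
   bounds the residual. *)
Lemma minimizer_step (beta lam : R) y u : BV_embedded_in_dual Y beta ->
  0 <= beta -> 0 < lam -> is_minimizer (calV Y lam (to_distribution y)) u ->
  exists y', [/\ to_distribution y - distr_div u = to_distribution y',
    `|y'| <= beta / (2 * lam) & (Linfty_norm u <= (lam * `|y| ^+ 2)%:E)%E].
Proof.
move=> hBV b0 lam0 [iu umin].
have [a a0 ua] := in_Linfty_fin iu.
have F0 : (calV Y lam (to_distribution y) u <= (lam * `|y| ^+ 2)%:E)%E.
  apply: le_trans (umin _ in_Linfty0.1) _.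
  rewrite /calV distr_div0 subr0 Ynorm_to_distribution -EFin_expe -EFinM.
  by rewrite -[leRHS]add0e leeD2r// in_Linfty0.2.
(* As [lam > 0], a residual outside Y would have infinite cost, against the finite cost of the field
   0. *)
have [y' yy'] : exists y', to_distribution y - distr_div u = to_distribution y'.
  apply: Ynorm_lty; rewrite ltey; apply/eqP => Yoo.
  move: F0; rewrite /calV Yoo ua.
  by rewrite expe2 mulyy gt0_muley ?lte_fin// addey// leye_eq.
have Fu : calV Y lam (to_distribution y) u = (a + lam * `|y'| ^+ 2)%:E.
  by rewrite /calV yy' Ynorm_to_distribution ua.
rewrite Fu lee_fin in F0.
exists y'; split => //; last first.
  by rewrite ua lee_fin (le_trans _ F0)// lerDl mulr_ge0 ?sqr_ge0// ltW.
have [h [ih hle divh]] := div_surjective hBV b0 y'.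
have key e : 0 < e -> e <= 1 ->
    lam * `|y'| ^+ 2 <= e * (beta * `|y'|) + lam * ((1 - e) * `|y'|) ^+ 2.
  move=> e0 e1; have [iv vle] := in_Linfty_lin e ih iu.
  have := umin _ iv; rewrite Fu {1}/calV distr_div_lin// divh.
  have -> : to_distribution y - (e *: to_distribution y' + distr_div u) =
      to_distribution ((1 - e) *: y').
    rewrite opprD addrCA yy' -[(1 - e) *: y']addr0 to_distribution_lin.
    have -> : to_distribution (0 : Y) = 0.
      have := to_distribution_lin (-1) (0 : Y) 0.
      by rewrite !scaleN1r !addNr.
    by rewrite addr0 scalerBl scale1r addrC.
  rewrite Ynorm_to_distribution -EFin_expe -EFinM normrZ ger0_norm ?subr_ge0//.
  move=> Fle; have : ((a + lam * `|y'| ^+ 2)%:E <=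
      (e * (beta * `|y'|) + a + lam * ((1 - e) * `|y'|) ^+ 2)%:E)%E.
    apply: le_trans Fle _; rewrite EFinD leeD2r// (le_trans vle)//.
    by rewrite ua EFinD leeD2r// gtr0_norm// EFinM lee_wpmul2l// lee_fin ltW.
  by rewrite lee_fin; lra.
have [->|y'0] := eqVneq y' 0; first by rewrite normr0 divr_ge0// mulr_ge0// ltW.
have n0 : 0 < `|y'| by rewrite normr_gt0.
(* Division of [key] by [e * |y'|], since [n^2 - ((1 - e) n)^2 = (2 - e) n * (e n)]. *)
have key' e : 0 < e -> e <= 1 -> lam * (2 - e) * `|y'| <= beta.
  move=> e0 e1; have := key e e0 e1; set n := `|y'| in n0 * => ley.
  rewrite -(@ler_pM2r _ (e * n)) ?mulr_gt0//.
  have -> : lam * (2 - e) * n * (e * n) =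
    lam * n ^+ 2 - lam * ((1 - e) * n) ^+ 2 by ring.
  by rewrite (_ : beta * (e * n) = e * (beta * n)); [lra|ring].
rewrite ler_pdivlMr ?mulr_gt0// leNgt; apply/negP => lt.
set n := `|y'| in n0 lt key'.
have ln : 0 < lam * n by rewrite mulr_gt0.
(* One value replaces the limit: this [e] makes [lam * (2 - e) * n] the midpoint of [2 * lam * n]
   and [beta], which exceeds [beta] under the assumption [lt]. That [e <= 1] uses [0 <= beta]. *)
pose e := (n * (2 * lam) - beta) / (2 * (lam * n)).
have e0 : 0 < e by rewrite divr_gt0 ?subr_gt0// mulr_gt0.
have e1 : e <= 1 by rewrite ler_pdivrMr ?mulr_gt0//; lra.
have := key' e e0 e1.
have -> : lam * (2 - e) * n = lam * n + beta / 2.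
  by rewrite /e; field; rewrite !gt_eqF.
lra.
Qed.

End minimizers.

Theorem theorem4p3 (R : realType) (d : nat) (hd : (2 <= d)%N)
  (Y : dual_distribution_space R d)
  (hY : frechet_differentiable_norm Y)
  (beta : R) (hBV : BV_embedded_in_dual Y beta)
  (f : Y) (hf : f != 0)
  (eta : R) (heta : eta = beta / 2)
  (lambda : nat -> R)
  (hlambda1 : lambda 1%N = 2 * eta / `|f|)
  (hlambda : forall j : nat, (1 <= j)%N -> lambda j = lambda 1%N * 2 ^+ (j - 1))
  (u : nat -> 'rV[R]_d -> 'rV[R]_d) (r : nat -> testfun R d -> R)
  (hr0 : r 0%N = to_distribution f)
  (hu : forall j : nat, (1 <= j)%N ->
    is_minimizer (calV Y (lambda j) (r (j - 1)%N)) (u j))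
  (hr : forall j : nat, (1 <= j)%N -> r j = r (j - 1)%N - distr_div (u j)) :
  exists U : 'rV[R]_d -> 'rV[R]_d,
    [/\ in_Linfty U,
        Linfty_norm (fun x => \sum_(1 <= j < n.+1) u j x - U x) @[n --> \oo]
          --> 0%E,
        distr_div U = to_distribution f
      & (Linfty_norm U <= (2 * beta * `|f|)%:E)%E].
Proof.
have b0 : 0 < beta := BV_embedded_gt0 hBV hf.
have nf : 0 < `|f| by rewrite normr_gt0.
have lamE j : lambda j.+1 = beta / `|f| * 2 ^+ j.
  by rewrite hlambda// subn1/= hlambda1 heta; field; rewrite gt_eqF.
have lam0 j : 0 < lambda j.+1 by rewrite lamE mulr_gt0 ?divr_gt0// exprn_gt0.
(* This is [lambda 1 * |f|^2], the bound for the first field. At each stage [lambda] doubles while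
   the bound on the squared residual is divided by 4, so the bound for the field is halved. *)
pose c := beta * `|f|.
have c0 : 0 < c by rewrite mulr_gt0.
(* The value of [lambda 1] is the one for which [beta / (2 * lambda 1) = |f| / 2]; doubling [lambda]
   then halves the residual bound again. *)
have step j (y : Y) : r j = to_distribution y -> `|y| <= `|f| / 2 ^+ j ->
    exists y' : Y, [/\ r j.+1 = to_distribution y', `|y'| <= `|f| / 2 ^+ j.+1
      & (Linfty_norm (u j.+1) <= (c / 2 ^+ j)%:E)%E].
  move=> rj yj; have := hu j.+1 isT; rewrite subn1/= rj => umin.
  have [y' [ry' y'le uj]] := minimizer_step hBV (ltW b0) (lam0 j) umin.
  exists y'; split; first by rewrite hr// subn1/= rj.
    rewrite (le_trans y'le)// lamE exprS le_eqVlt; apply/orP; left; apply/eqP.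
    by field; rewrite ?expf_neq0// !gt_eqF.
  rewrite (le_trans uj)// lee_fin.
  rewrite (@le_trans _ _ (lambda j.+1 * (`|f| / 2 ^+ j) ^+ 2))//.
    by rewrite ler_pM2l// lerXn2r// nnegrE// divr_ge0// exprn_ge0.
  rewrite lamE /c le_eqVlt; apply/orP; left; apply/eqP.
  by field; rewrite ?expf_neq0// gt_eqF.
have ry j : exists2 y : Y, r j = to_distribution y & `|y| <= `|f| / 2 ^+ j.
  elim: j => [|j [y rj yj]]; first by exists f => //; rewrite expr0 divr1.
  by have [y' [ry' y'le _]] := step j y rj yj; exists y'.
have ule j : (Linfty_norm (u j.+1) <= (c / 2 ^+ j)%:E)%E.
  by have [y rj yj] := ry j; have [y' []] := step j y rj yj.
have iu j : in_Linfty (u j.+1) by have [] := hu j.+1 isT.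
have [U [iU Ule]] := Linfty_series iu ule.
pose S n x : 'rV[R]_d := \sum_(0 <= j < n) u j.+1 x.
have SE n x : \sum_(1 <= j < n.+1) u j x = S n x by rewrite /S big_add1.
have S_div n : in_Linfty (S n) /\ distr_div (S n) = to_distribution f - r n.
  elim: n => [|n [iS dS]].
    have -> : S 0 = 0 by apply/funext => x; rewrite /S big_geq.
    by rewrite hr0 subrr distr_div0; split => //; exact: (in_Linfty0 R d).1.
  have SS : S n.+1 = fun x => 1 *: S n x + u n.+1 x.
    by apply/funext => x; rewrite /S big_nat_recr//= scale1r.
  rewrite SS distr_div_lin// dS scale1r (hr n.+1)// subn1/= opprB addrA addrAC.
  by split; [exact: (in_Linfty_lin 1 iS (iu n)).1|rewrite addrAC].
have cvg0 (K : R) : K / 2 ^+ n @[n --> \oo] --> (0 : R).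
  under eq_fun do rewrite -exprVn; apply: cvg_geometric.
  by rewrite ger0_norm ?invr_ge0// invf_lt1// ltr1n.
exists U; split => //.
- under eq_fun => n do under [X in Linfty_norm X]eq_fun do rewrite SE.
  apply: (@squeeze_cvge _ _ _ _ (cst 0%E) _ (fun n => (2 * c / 2 ^+ n)%:E)).
  + by apply: nearW => n; rewrite Linfty_norm_ge0 Ule.
  + exact: cvg_cst.
  + by apply: cvg_EFin; [exact: nearW|exact: cvg0].
(* For every [n], the defect of the equation at [phi] is the divergence of [S n - U] plus the
   residual [r n]. Both are of order [1 / 2 ^+ n] times the integral of [|grad phi|]. *)
- apply/funext => phi; apply/eqP; rewrite -subr_eq0 -normr_le0.
  pose g := \int[lebesgue_rV R d]_x euclid_norm (grad phi x).
  have g0 : 0 <= g by apply: Rintegral_ge0 => x _; exact: euclid_norm_ge0.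
  apply: (cvgr_to_ge (cvg0 ((2 * c + beta * `|f|) * g))); apply: nearW => n.
  have [iS dS] := S_div n.
  have [y rn yn] := ry n.
  have [iSU _] := in_Linfty_lin (-1) iU iS.
  have SUle : (Linfty_norm (fun x => (- 1 *: U x + S n x)%R) <=
      (2 * c / 2 ^+ n)%:E)%E.
    by under [X in Linfty_norm X]eq_fun do rewrite scaleN1r addrC; exact: Ule.
  have C0 : 0 <= 2 * c / 2 ^+ n by rewrite divr_ge0 ?exprn_ge0// mulr_ge0// ltW.
  have := distr_div_le phi iSU C0 SUle; rewrite distr_div_lin// dS rn -/g.
  have [t [t0 tg yt]] := BV_embedded_testfun_bound hBV y phi.
  have yle : `|to_distribution y phi| <= beta * `|f| * g / 2 ^+ n.
    rewrite (le_trans yt)// (_ : _ / _ = beta * g * (`|f| / 2 ^+ n)); last by ring.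
    by rewrite ler_pM ?mulr_ge0 ?(ltW b0)// ler_pM2l.
  rewrite (_ : (_ + _) phi = -1 * distr_div U phi +
    (to_distribution f phi - to_distribution y phi))// mulN1r.
  move=> dle; rewrite -normrN opprB.
  have -> : to_distribution f phi - distr_div U phi = (- distr_div U phi +
    (to_distribution f phi - to_distribution y phi)) + to_distribution y phi by ring.
  rewrite (le_trans (ler_normD _ _))// (le_trans (lerD dle yle))//.
  by rewrite le_eqVlt; apply/orP; left; apply/eqP; ring.
(* For [n = 0] the partial sum is empty, so the tail estimate is the norm bound for [U] itself. *)
- have := Ule 0; rewrite expr0 divr1 mulrA => /Linfty_norm_leP U0.
  apply/Linfty_norm_leP; apply: filterS U0 => x.
  by rewrite big_geq// sub0r euclid_normN.
Qed.
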